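(* Assume the setting and hypotheses (H(A)), (H(J)), (H($\iota$)), (H(f)), (H(0)) described in the context. For $N\in\mathbb N$ let $\tau=T/N$ and let $u_\tau^0\in V$ be given. Then there exists $\tau_0>0$ such that for all $0<\tau<\tau_0$, Problem $\mathcal P_\tau$ has a solution, i.e. there exist $\{u_\tau^n\}_{n=1}^N\subset V$ and $\{\xi_\tau^n\}_{n=1}^N\subset U^*$ such that $$\tfrac1\tau(u_\tau^1-u_\tau^0)+Au_\tau^1+\iota^*\xi_\tau^1=f_\tau^1,\qquad \xi_\tau^1\in\partial J(\iota u_\tau^1),$$ and for $n=2,\dots,N$, $$\tfrac1\tau\Big(\tfrac32u_\tau^n-2u_\tau^{n-1}+\tfrac12u_\tau^{n-2}\Big)+Au_\tau^n+\iota^*\xi_\tau^n=f_\tau^n,\qquad \xi_\tau^n\in\partial J(\iota u_\tau^n),$$ where $f_\tau^1=\frac1\tau\int_0^\tau f(t)\,dt$ and $f_\tau^n=\frac{3}{2\tau}\int_{(n-1)\tau}^{n\tau}f(t)\,dt-\frac{1}{2\tau}\int_{(n-2)\tau}^{(n-1)\tau}f(t)\,dt$ for $n=2,\dots,N$.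
   Context: $V$ is a real reflexive separable Banach space with norm $\|\cdot\|$, $H$ is a real separable Hilbert space with inner product $(\cdot,\cdot)$ and norm $|\cdot|$, identified with its dual, and $V\subset H\subset V^*$ with dense continuous embeddings, the embedding $V\subset H$ being compact; $\langle\cdot,\cdot\rangle$ is the duality pairing of $V^*$ and $V$, with $\langle u,v\rangle=(u,v)$ for $u\in H$, $v\in V$. $U$ is a reflexive Banach space, $T>0$. For a locally Lipschitz $J\colon U\to\mathbb R$, the Clarke generalized directional derivative is $J^0(x;v)=\limsup_{y\to x,\lambda\downarrow0}\frac{J(y+\lambda v)-J(y)}{\lambda}$ and the Clarke subdifferential is $\partial J(x)=\{\xi\in U^*:J^0(x;v)\ge\langle\xi,v\rangle_{U^*\times U}\ \forall v\in U\}$. $\iota^*\colon U^*\to V^*$ denotes the adjoint of $\iota$. Hypotheses: (H(A)) $A\colon V\to V^*$ is pseudomonotone (i.e. whenever $v_n\to v$ weakly in $V$ and $\limsup_n\langle Av_n,v_n-v\rangle\le0$, then $\langle Av,v-y\rangle\le\liminf_n\langle Av_n,v_n-y\rangle$ for every $y\in V$), $\|Av\|_{V^*}\le a+b\|v\|$ for all $v\in V$ with $a\ge0$, $b>0$, and $\langle Av,v\rangle\ge\alpha\|v\|^2-\beta|v|^2$ for all $v\in V$ with $\alpha>0$, $\beta\ge0$. (H(J)) $J\colon U\to\mathbb R$ is locally Lipschitz and $\|\xi\|_{U^*}\le d(1+\|u\|_U)$ for all $u\in U$, $\xi\in\partial J(u)$, with $d>0$. (H($\iota$)) $\iota\colon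 V\to U$ is linear, continuous and compact, and there is a Banach space $Z$ with $V\subset Z\subset H$, $V\subset Z$ compact, $Z\subset H$ continuous, such that $\iota=\iota_2\circ\iota_1$ with $\iota_1\colon V\to Z$ the identity and $\iota_2\colon Z\to U$ linear continuous. (H(f)) $f\in L^2(0,T;V^* )$. (H(0)) $u_0\in H$. *)

(* Defs.v *)
From HB Require Import structures.
From mathcomp Require Import all_boot all_order all_algebra.
From mathcomp Require Import all_classical all_reals all_analysis.
Set Implicit Arguments. Unset Strict Implicit. Unset Printing Implicit Defensive.
Import Order.TTheory GRing.Theory Num.Theory.
Import numFieldNormedType.Exports.
Local Open Scope classical_set_scope.
Local Open Scope ring_scope.

Definition is_linear (R : realType) (X Y : normedModType R) (g : X -> Y) :=
  forall (a : R) (x y : X), g (a *: x + y) = a *: g x + g y.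

Definition is_dual (R : realType) (X : normedModType R) (g : X -> R) :=
  (forall (a : R) (x y : X), g (a *: x + y) = a * g x + g y) /\ continuous g.

Definition dnorm (R : realType) (X : normedModType R) (g : X -> R) : R :=
  sup [set `|g x| | x in [set x : X | `|x| <= 1]].

Definition bounded_set (R : realType) (X : normedModType R) (B : set X) :=
  exists M : R, forall x, B x -> `|x| <= M.

Definition compact_op (R : realType) (X Y : normedModType R) (g : X -> Y) :=
  forall B : set X, bounded_set B -> compact (closure (g @` B)).

Definition separable_space (T : topologicalType) :=
  exists S : set T, countable S /\ closure S = setT.

(* Reflexive: the canonical map X -> X^** is onto.  A bidual element is a
   functional Phi on X^* (only its values on X^* matter) that is linear and
   bounded w.r.t. the dual norm. *)
Definition reflexive_space (R : realType) (X : normedModType R) :=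
  forall Phi : (X -> R) -> R,
    (forall (a : R) (g1 g2 : X -> R), is_dual g1 -> is_dual g2 ->
        Phi (fun x => a * g1 x + g2 x) = a * Phi g1 + Phi g2) ->
    (exists C : R, forall g, is_dual g -> `|Phi g| <= C * dnorm g) ->
    exists x : X, forall g, is_dual g -> Phi g = g x.

Definition weak_cvg (R : realType) (X : normedModType R) (xn : nat -> X) (x : X) :=
  forall g : X -> R, is_dual g -> (fun n => g (xn n)) @ \oo --> g x.

(* Pseudomonotone operator A : V -> V^* (A v is given as a functional on V). *)
Definition pseudomonotone (R : realType) (V : normedModType R) (A : V -> V -> R) :=
  forall (vn : nat -> V) (v : V), weak_cvg vn v ->
    (limn_esup (fun n => (A (vn n) (vn n - v))%:E) <= 0%:E)%E ->
    forall y : V,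
      ((A v (v - y))%:E <= limn_einf (fun n => (A (vn n) (vn n - y))%:E))%E.

Definition loc_lipschitz (R : realType) (X : normedModType R) (J : X -> R) :=
  forall x : X, exists r : R, 0 < r /\ exists L : R,
    forall y z : X, `|y - x| < r -> `|z - x| < r -> `|J y - J z| <= L * `|y - z|.

(* Clarke generalized directional derivative
   J^0(x;v) = limsup_{y -> x, lambda ↓ 0} (J(y + lambda v) - J y)/lambda,
   written as inf_{delta>0} sup_{|y-x|<delta, 0<lambda<delta}. *)
Definition clarke_dd (R : realType) (X : normedModType R) (J : X -> R) (x v : X)
  : \bar R :=
  ereal_inf [set ereal_sup
      [set z : \bar R | exists (y : X) (lam : R),
         `|y - x| < delta /\ 0 < lam < delta /\
         z = ((J (y + lam *: v) - J y) / lam)%:E]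
    | delta in [set d : R | 0 < d]].

Definition clarke_subdiff (R : realType) (X : normedModType R) (J : X -> R)
  (x : X) (xi : X -> R) :=
  is_dual xi /\ forall v : X, ((xi v)%:E <= clarke_dd J x v)%E.

Definition Icc (R : realType) (a b : R) : set R := `[a, b].

Definition hilbert_ip (R : realType) (H : normedModType R) (ip : H -> H -> R) :=
  (forall (a : R) (x y z : H), ip (a *: x + y) z = a * ip x z + ip y z) /\
  (forall x y : H, ip x y = ip y x) /\
  (forall x : H, ip x x = `|x| ^+ 2).

(* f in L^2(0,T;V^* ): weakly (hence, by Pettis and separability, strongly)
   measurable, with ||f(.)||_{V^*} measurable and square integrable. *)
Definition L2_dual (R : realType) (V : normedModType R) (T : R) (f : R -> V -> R) :=
  (forall t, 0 <= t <= T -> is_dual (f t)) /\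
  (forall v : V, measurable_fun (Icc 0 T) (fun t => f t v)) /\
  measurable_fun (Icc 0 T) (fun t => dnorm (f t)) /\
  (\int[lebesgue_measure]_(t in Icc 0 T) ((dnorm (f t)) ^+ 2)%:E < +oo)%E.

(* Integral of f over [a,b], as an element of V^* (acting on v). *)
Definition dint (R : realType) (V : normedModType R) (f : R -> V -> R) (a b : R)
  (v : V) : R :=
  fine (\int[lebesgue_measure]_(t in Icc a b) (f t v)%:E)%E.

(* Main.v *)
Require Import Defs.
From HB Require Import structures.
From mathcomp Require Import all_boot.
Set Implicit Arguments. Unset Strict Implicit. Unset Printing Implicit Defensive.

(* Each time step asks for [x] and [xi] in the Clarke subdifferential at
   [iota x] with [kappa (x, v) + A x v + xi (iota v) = F v] for all [v], where
   [kappa] is [1/tau] or [3/(2 tau)].  By Hahn-Banach it is enough to find [x]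
   with [kappa (x, v) + A x v - F v + J0 (iota x; iota v) >= 0] for all [v]: the
   linear functional [F - kappa (x, .) - A x] is then dominated by the sublinear
   [J0 (iota x; iota .)] and extends to a dominated functional on [U].

   The left-hand side [phi x v] is sublinear in [v], so Ky Fan's principle gives,
   for the first [m] members of a dense sequence [w_i], a point [u_m] with
   [phi u_m (w_i - u_m) >= 0] for [i < m]; no Galerkin subspaces are needed.
   Testing with [w_0 = 0] bounds [u_m] in [V], because Ehrling's lemma absorbs
   [|iota u|^2] into the coercivity of [A] and into [kappa |u|^2] once [kappa] is
   large.  A subsequence converges strongly in [Z], hence in [H] and [U], and
   weakly in [V]; pseudomonotonicity lets [m] tend to infinity.

   Ky Fan's principle rests on KKM, obtained from Scarf's combinatorial lemma on
   a finite set carrying several linear orders, which replaces triangulations. *)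

(** * Scarf's lemma *)

(** The step is solved in the form [phi x v >= 0] because [J0] is single-valued and upper
    semicontinuous; a subgradient is chosen only once, at the limit, so no selection from the
    subdifferential has to survive the passage to the limit. The obstacle is that pseudomonotonicity
    says nothing until [A u_m (u_m - x)] is asymptotically nonpositive, while [x] itself is not
    among the test points [w_i]. This is repaired by testing with some [w_i] near [x] and paying for
    the difference with the growth bound of [A] on the bounded sequence and with a bound
    [phi x v <= C |v|]. All other terms pass to the limit by strong convergence in [H] and [U].
    Since [iota] may have a kernel, compactness is read off in [Z], which injects into [H]; this
    injection also drives Ehrling's lemma and identifies the weak limit. The threshold for [kappa]
    comes from the constants of [A], [J] and the embeddings alone, not from [F], hence not from
    earlier iterates: one bound on [tau] serves all time steps. *)

Section Scarf.
Variables (I X : finType) (r : I -> X -> nat) (l : X -> I).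
Hypothesis r_inj : forall i, injective (r i).

(** Scarf's dominance: no [y] is strictly above the lowest member of [s] in all the orders of [C] at
    once. Shrinking [s] or enlarging [C] preserves it, which explains the opposite inclusions in
    [scarf_adj]. *)
Definition dominant (s : {set X}) (C : {set I}) :=
  [forall y, exists i in C, forall x in s, r i y <= r i x].

Definition scarf_cell (c : {set X} * {set I}) :=
  dominant c.1 c.2 && (#|c.1| == #|c.2|).

(** By the cardinalities, the labels are injective on [d.1] and miss exactly [k] in [d.2]. *)
Definition scarf_door (k : I) (d : {set X} * {set I}) :=
  [&& dominant d.1 d.2, #|d.2| == #|d.1|.+1, k \in d.2 & l @: d.1 == d.2 :\ k].

Definition scarf_adj (c d : {set X} * {set I}) :=
  (d.1 \subset c.1) && (c.2 \subset d.2).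

Lemma dominantP (s : {set X}) (C : {set I}) :
  reflect (forall y, exists2 i, i \in C & forall x, x \in s -> r i y <= r i x)
          (dominant s C).
Proof.
apply: (iffP forallP) => [h y|h y].
  have /exists_inP[i iC /forall_inP ix] := h y.
  by exists i.
have [i iC ix] := h y; apply/exists_inP; exists i => //.
by apply/forall_inP.
Qed.

Lemma dominantS (s t : {set X}) (C D : {set I}) :
  t \subset s -> C \subset D -> dominant s C -> dominant t D.
Proof.
move=> ts CD /dominantP dom; apply/dominantP => y.
have [i iC h] := dom y; exists i; first exact: (subsetP CD).
by move=> x xt; apply/h/(subsetP ts).
Qed.

Definition rmin_in (s : {set X}) x0 i := [arg min_(x < x0 in s) r i x].

Lemma rmin_inP (s : {set X}) x0 i : x0 \in s ->
  rmin_in s x0 i \in s /\ forall x, x \in s -> r i (rmin_in s x0 i) <= r i x.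
Proof. by move=> x0s; rewrite /rmin_in; case: arg_minnP. Qed.

Lemma rmin_in_eq (s : {set X}) x0 i x : x0 \in s -> x \in s ->
  (forall y, y \in s -> r i x <= r i y) -> rmin_in s x0 i = x.
Proof.
move=> x0s xs h; have [ms mmin] := rmin_inP i x0s.
by apply: (@r_inj i); apply/eqP; rewrite eqn_leq mmin // h.
Qed.

(** Dominance applied to a point of [s] makes it the minimum of [s] in some order of [C]. Hence
    minima biject with indices in a cell, and exactly one collision of minima occurs in a door. *)
Lemma rmin_in_onto (s : {set X}) x0 (C : {set I}) :
  x0 \in s -> dominant s C -> rmin_in s x0 @: C = s.
Proof.
move=> x0s /dominantP dom; apply/setP => x; apply/imsetP/idP.
  by case=> i _ ->; case: (rmin_inP i x0s).
move=> xs; have [i iC h] := dom x; exists i => //.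
by rewrite (@rmin_in_eq s x0 i x).
Qed.

(* The two ways of completing a door drop one of the two indices sharing a
   minimal element, or add the best point among those which obstruct this. *)
Section Pivot.
Variables (t : {set X}) (D : {set I}) (x0 : X).
Hypotheses (x0t : x0 \in t) (domt : dominant t D) (cardD : #|D| = #|t|.+1).

Let m := rmin_in t x0.
Let m_in i : m i \in t. Proof. by case: (rmin_inP i x0t). Qed.
Let m_min i x : x \in t -> r i (m i) <= r i x.
Proof. by case: (rmin_inP i x0t) => _; apply. Qed.

Lemma shared_min : exists i j, [/\ i \in D, j \in D, i != j & m i = m j].
Proof.
have /dinjectivePn[i iD [j]] : ~~ dinjectiveb m D.
  apply/negP => /dinjectiveP inj.
  have := card_in_imset inj; rewrite rmin_in_onto // cardD => /eqP.
  by rewrite ltn_eqF.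
rewrite inE => /andP[ji jD] mij.
by exists i, j; split => //; rewrite eq_sym.
Qed.

(** The points left undominated once the index [e] is dropped. *)
Definition obstr (e : I) : {set X} :=
  [set y | [forall c in D :\ e, r c (m c) < r c y]].

Lemma obstrP e y : reflect (forall c, c \in D -> c != e -> r c (m c) < r c y)
  (y \in obstr e).
Proof.
rewrite inE; apply: (iffP forall_inP) => h c.
  by move=> cD ce; apply: h; rewrite !inE ce.
by rewrite !inE => /andP[ce cD]; apply: h.
Qed.

Lemma dominant_drop e : dominant t (D :\ e) = (obstr e == set0).
Proof.
apply/dominantP/eqP => [dom|ob0 y].
  apply/setP => y; rewrite in_set0; apply/negP => /obstrP yo.
  have [i] := dom y; rewrite !inE => /andP[ie iD] /(_ _ (m_in i)).
  by rewrite leqNgt yo.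
have : y \notin obstr e by rewrite ob0 inE.
rewrite inE negb_forall_in => /exists_inP[i iD]; rewrite -leqNgt => h.
by exists i => // x xt; apply: (leq_trans h); apply: m_min.
Qed.


(** Only [e] can be the index that dominates [y]; equality with the minimum would put [y] at [m e'],
    although [y] is strictly above it in the order [e']. *)
Lemma obstr_lt e e' y : e' \in D -> e != e' -> m e = m e' ->
  y \in obstr e -> e \in D /\ r e y < r e (m e).
Proof.
move=> e'D ee' mee' /obstrP yo.
have [i iD /(_ _ (m_in i)) h] := dominantP _ _ domt y.
have [ie|ie] := eqVneq i e; last by have := yo _ iD ie; rewrite ltnNge h.
rewrite -ie; split=> //; rewrite ltn_neqAle h andbT; apply/eqP => /r_inj ymi.
have := yo e' e'D; rewrite eq_sym ee' => /(_ isT).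
by rewrite ymi ie mee' ltnn.
Qed.

Definition drop_cell e := (t, D :\ e).
Definition add_cell y := (y |: t, D).

(** A point [z] obstructing [e] is now dominated through [e], by maximality of [y]; any other [z]
    keeps an index [c] different from [e], for which [y] lies above [m c]. *)
Lemma add_cellP e e' y : e' \in D -> e != e' -> m e = m e' ->
  y \in obstr e -> (forall z, z \in obstr e -> r e z <= r e y) ->
  scarf_cell (add_cell y).
Proof.
move=> e'D ee' mee' yo ymax; rewrite /scarf_cell /=.
have [eD ylt] := obstr_lt e'D ee' mee' yo.
have ynt : y \notin t.
  by apply/negP => /(m_min e); rewrite leqNgt ylt.
rewrite cardsU1 ynt cardD eqxx andbT; apply/dominantP => z.
have [/ymax zo|] := boolP (z \in obstr e).
  exists e => // x; rewrite !inE => /orP[/eqP->//|xt].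
  by rewrite (leq_trans zo)// (leq_trans (ltnW ylt))// m_min.
rewrite inE negb_forall_in => /exists_inP[c]; rewrite !inE => /andP[ce cD].
rewrite -leqNgt => h; exists c => // x; rewrite !inE => /orP[/eqP->|xt].
  by rewrite (leq_trans h)// ltnW//; apply: (obstrP _ _ yo).
by rewrite (leq_trans h)// m_min.
Qed.

(** Each index [e] of the colliding pair yields one completion. Conversely, in a cell the minima are
    injective on the indices, so the index dropped, or the one whose minimum the new point becomes,
    must belong to that pair. *)
Lemma pivot : exists c1 c2, c1 != c2 /\
  forall c, (scarf_cell c && scarf_adj c (t, D)) = (c == c1) || (c == c2).
Proof.
have [i [j [iD jD ij mij]]] := shared_min.
pose nb e := if [pick y in obstr e] is Some y0
  then add_cell [arg max_(y > y0 in obstr e) r e y] else drop_cell e.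
have ij' : j != i by rewrite eq_sym.
have nbP e : (obstr e = set0 /\ nb e = drop_cell e) \/
   exists y, [/\ y \in obstr e, (forall z, z \in obstr e -> r e z <= r e y) &
              nb e = add_cell y].
  rewrite /nb; case: pickP => [y0 y0o|ob0].
    by right; case: arg_maxnP => // y yo ymax; exists y.
  by left; split => //; apply/setP => y; rewrite in_set0 -(ob0 y).
have cardDe e : e \in D -> #|D :\ e| = #|t|.
  by move=> eD; have := cardsD1 e D; rewrite eD cardD add1n => -[].
have nb_cell e e' : e \in D -> e' \in D -> e != e' -> m e = m e' ->
    scarf_cell (nb e) && scarf_adj (nb e) (t, D).
  move=> eD e'D ee' mee'; have [[ob0 ->]|[y [yo ymax ->]]] := nbP e.
    rewrite /scarf_cell /scarf_adj /= dominant_drop ob0 eqxx cardDe// eqxx.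
    by rewrite subxx subsetDl.
  by rewrite (add_cellP e'D ee' mee')// /scarf_adj /= subsetUr subxx.
have exch s C y : scarf_cell (s, C) -> y \in s -> y \notin t -> t \subset s ->
    C \subset D -> s = y |: t /\ C = D.
  move=> /andP[/= _ /eqP cs] ys yt ts CD.
  have sub : y |: t \subset s by rewrite subUset sub1set ys.
  have sE : y |: t = s.
    apply/eqP; rewrite eqEcard sub/= cs cardsU1 yt add1n -cardD.
    exact: subset_leq_card.
  split=> //; apply/eqP; rewrite eqEcard CD cardD -cs -sE cardsU1 yt.
  by rewrite add1n ltnSn.
exists (nb i), (nb j); split.
  have [[_ ->]|[y [yo _ ->]]] := nbP i; have [[_ ->]|[z [zo _ ->]]] := nbP j.
  - apply/eqP => /(congr1 snd) /= /setP/(_ j); rewrite !inE jD ij' eqxx.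
    by [].
  - apply/eqP => /(congr1 snd) /= /setP/(_ i); rewrite !inE eqxx iD.
    by [].
  - apply/eqP => /(congr1 snd) /= /setP/(_ j); rewrite !inE eqxx jD.
    by [].
  (* The added points differ: in the order [j], [y] lies above the shared minimum and [z] below
     it. *)
  apply/eqP => /(congr1 fst) /= /setP/(_ y); rewrite !inE eqxx /=.
  have [_ ylt] := obstr_lt jD ij mij yo.
  have -> : y \in t = false.
    by apply/negP => /(m_min i); rewrite leqNgt ylt.
  rewrite orbF => /esym/eqP yz; have [_] := obstr_lt iD ij' (esym mij) zo.
  by rewrite -yz ltnNge ltnW// (obstrP _ _ yo).
move=> [s C]; apply/idP/orP; last first.
  by case=> /eqP ->; [apply: nb_cell ij mij|apply: nb_cell ij' (esym mij)].
move=> /andP[cell /andP[/= ts CD]].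
have minj (s' : {set X}) x (C' : {set I}) : x \in s' -> dominant s' C' -> #|s'| = #|C'| ->
    {in C' &, injective (rmin_in s' x)}.
  move=> xs' dom' card'; apply/imset_injP; rewrite rmin_in_onto//.
  by rewrite card'.
have [/= doms /eqP cards] := andP cell.
suff [e [eij H]] : exists e, (e = i \/ e = j) /\
    ((obstr e = set0 /\ (s, C) = drop_cell e) \/
     exists y, [/\ y \in obstr e, (forall z, z \in obstr e -> r e z <= r e y) &
              (s, C) = add_cell y]).
  have -> : (s, C) = nb e.
    have [[ob0 ->]|[y [yo ym ->]]] := H; have [[ob0' ->]|[z [zo zm ->]]] := nbP e => //.
    - by rewrite ob0 inE in zo.
    - by rewrite ob0' inE in yo.
    congr (add_cell _); apply: (@r_inj e); apply/eqP.
    by rewrite eqn_leq zm// ym.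
  by case: eij => ->; [left|right].
have [tE|tns] := eqVneq t s.
  subst s; have /set0Pn[e] : D :\: C != set0.
    by rewrite -card_gt0 cardsDS// cardD cards subSnn.
  rewrite inE => /andP[eC eD].
  have CE : C = D :\ e.
    apply/eqP; rewrite eqEcard cardDe// cards leqnn andbT.
    apply/subsetP => c cC; rewrite !inE (subsetP CD)// andbT.
    by apply: contraNneq eC => <-.
  exists e; split.
    have [->|ie] := eqVneq e i; first by left.
    have [->|je] := eqVneq e j; first by right.
    have := @minj t x0 C x0t doms cards i j; rewrite CE !inE iD jD.
    by rewrite eq_sym ie eq_sym je => /(_ isT isT mij) /eqP; rewrite (negPf ij).
  by left; split; [apply/eqP; rewrite -dominant_drop -CE|rewrite /drop_cell CE].
have [ts' [y ys yt]] : t \subset s /\ exists2 y, y \in s & y \notin t.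
  split=> //; have /properP[] // : t \proper s by rewrite properEneq tns.
have [sE CE] := exch _ _ _ cell ys yt ts CD; subst C.
have x0s : x0 \in s by exact: (subsetP ts).
have inj := minj _ _ _ x0s doms cards.
have /imsetP[e eD yE] : y \in rmin_in s x0 @: D by rewrite rmin_in_onto.
have m'E c : c \in D -> c != e -> rmin_in s x0 c = m c.
  move=> cD ce; have [ms mmin] := rmin_inP c x0s.
  rewrite /m (@rmin_in_eq t x0 c (rmin_in s x0 c))//.
    move: ms; rewrite {2}sE !inE => /orP[/eqP|//].
    by rewrite yE => /(inj _ _ cD eD) /eqP; rewrite (negPf ce).
  by move=> x xt; apply/mmin/(subsetP ts).
have yo : y \in obstr e.
  apply/obstrP => c cD ce; rewrite ltn_neqAle -(m'E c)//.
  have [_ mmin] := rmin_inP c x0s; rewrite mmin// andbT.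
  by apply/eqP => /r_inj; rewrite yE => /(inj _ _ cD eD) /eqP; rewrite (negPf ce).
exists e; split.
  have [->|ie] := eqVneq e i; first by left.
  have [->|je] := eqVneq e j; first by right.
  have := inj i j iD jD; rewrite !m'E// 1?eq_sym// => /(_ mij) /eqP.
  by rewrite (negPf ij).
right; exists y; split=> //; last by rewrite /add_cell sE.
move=> z /obstrP zo; have [c cD cz] := dominantP _ _ doms z.
have [<-|ce] := eqVneq c e; first exact: cz.
have := zo c cD ce; rewrite ltnNge cz//; apply: (subsetP ts); exact: m_in.
Qed.
End Pivot.

Lemma door_adj_cases k (s t : {set X}) (C D : {set I}) :
  scarf_cell (s, C) -> scarf_door k (t, D) -> scarf_adj (s, C) (t, D) ->
  (t = s /\ exists2 j, j \notin C & D = j |: C) \/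
  (D = C /\ exists2 x, x \in s & t = s :\ x).
Proof.
move=> /andP[/= _ /eqP cs] /and4P[/= _ /eqP cD _ _] /andP[/= ts CD].
have [tE|tns] := eqVneq t s.
  left; split=> //.
  have CpD : C \proper D by rewrite properEcard CD cD tE cs ltnSn.
  have /properP[_ [j jD jC]] := CpD; exists j => //; apply/eqP.
  rewrite eq_sym eqEcard subUset sub1set jD CD/= cD tE cs cardsU1 jC.
  by rewrite add1n leqnn.
right; have pts : t \proper s by rewrite properEneq tns.
have DE : D = C.
  apply/eqP; rewrite eq_sym eqEcard CD cD -cs.
  exact: proper_card.
split=> //; have /properP[_ [x xs xt]] := pts; exists x => //.
apply/eqP; rewrite eqEcard subsetD1 ts xt/=.
by have := cardsD1 x s; rewrite xs cs -DE cD add1n => -[->].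
Qed.

(** If the labels of [s] are [C :\ k] plus one [j] outside [C], the doors are obtained by adding [j]
    to [C] or by dropping the point labelled [j]. If they are exactly [C :\ k], two points share a
    label and either may be dropped. Otherwise there is no door. *)
Lemma even_doors k c : scarf_cell c -> l @: c.1 != c.2 ->
  ~~ odd #|[set d | scarf_door k d && scarf_adj c d]|.
Proof.
case: c => s C /= cell nrb; have /andP[/= doms /eqP cs] := cell.
have kC d : scarf_door k d -> scarf_adj (s, C) d -> k \in C.
  case: d => t D door adj; have /and4P[/= _ _ kD /eqP lE] := door.
  have [[tE [j jC DE]]|[DE [x xs tE]]] := door_adj_cases cell door adj; last first.
    by rewrite -DE.
  move: kD; rewrite DE !inE => /orP[/eqP kj|//].
  by move: nrb; rewrite -tE lE DE -kj setU1K ?eqxx// kj.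
have doorB x : x \in s -> k \in C ->
    scarf_door k (s :\ x, C) && scarf_adj (s, C) (s :\ x, C) =
    (l @: (s :\ x) == C :\ k).
  move=> xs kC'; rewrite /scarf_door /scarf_adj /= subxx subsetDl !andbT kC' /=.
  rewrite (dominantS _ _ doms) ?subsetDl//= -cs.
  by have := cardsD1 x s; rewrite xs add1n => ->; rewrite eqxx.
have doorA j : j \notin C -> k \in C ->
    scarf_door k (s, j |: C) && scarf_adj (s, C) (s, j |: C) =
    (l @: s == j |: (C :\ k)).
  move=> jC kC'; rewrite /scarf_door /scarf_adj /= subxx subsetUr !andbT.
  rewrite (dominantS _ _ doms) ?subsetUr//= !inE kC' orbT/= cardsU1 jC cs eqxx/=.
  congr (_ == _); apply/setP => y; rewrite !inE.
  by have [->|yj] := eqVneq y j => //=; rewrite andbT; apply: contraNneq jC => ->.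
have sx x : x \in s -> l @: s = l x |: l @: (s :\ x).
  by move=> xs; rewrite -{1}(setD1K xs) imsetU1.
have [/existsP[j /andP[jC /eqP lE]]|noA] :=
    boolP [exists j, (j \notin C) && (l @: s == j |: (C :\ k))].
  have [kC'|kC'] := boolP (k \in C); last first.
    rewrite (_ : finset _ = set0) ?cards0//; apply/setP => d; rewrite !inE.
    by apply: contraNF kC' => /andP[]; apply: kC.
  have linj : {in s &, injective l}.
    apply/imset_injP; rewrite lE cardsU1 !inE (negPf jC) andbF cs.
    by have := cardsD1 k C; rewrite kC' => <-.
  have /imsetP[x xs jE] : j \in l @: s by rewrite lE !inE eqxx.
  have lxE : l @: (s :\ x) = C :\ k.
    apply/setP => i; have := sx x xs; rewrite lE -jE => /setP/(_ i).
    rewrite !inE; have [->|//] := eqVneq i j.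
    move=> _; rewrite (negPf jC) andbF; apply/negbTE/imsetP => -[y].
    rewrite !inE => /andP[yx ys]; rewrite jE => /linj xy.
    by rewrite xy ?eqxx in yx.
  rewrite (_ : finset _ = [set (s, j |: C); (s :\ x, C)]); last first.
    apply/setP => -[t D]; rewrite !inE; apply/idP/orP; last first.
      by case=> /eqP ->; [rewrite doorA// lE|rewrite doorB// lxE].
    move=> /andP[door adj].
    have [[tE [i iC DE]]|[DE [y ys tE]]] := door_adj_cases cell door adj.
      left; move: door adj; rewrite tE DE => door adj.
      have := doorA i iC kC'; rewrite door adj lE => /esym/eqP/setP/(_ i).
      rewrite !inE eqxx (negPf iC) andbF/= orbF => /eqP->.
      exact: eqxx.
    right; move: door adj; rewrite tE DE => door adj.
    have := doorB y ys kC'; rewrite door adj => /esym/eqP/setP/(_ j).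
    rewrite !inE (negPf jC) andbF => jny; have [->//|yx] := eqVneq y x.
    suff : j \in l @: (s :\ y) by rewrite jny.
    by rewrite jE imset_f // !inE xs eq_sym yx.
  rewrite cards2; case: eqVneq => //= /(congr1 fst)/= /setP/(_ x).
  by rewrite !inE eqxx xs.
have [/eqP lE|nB] := boolP (l @: s == C :\ k); last first.
  rewrite (_ : finset _ = set0) ?cards0//; apply/setP => -[t D]; rewrite !inE.
  apply/negP => /andP[door adj]; have kC' := kC _ door adj.
  have [[tE [i iC DE]]|[DE [y ys tE]]] := door_adj_cases cell door adj.
    move: door adj; rewrite tE DE => door adj.
    have := doorA i iC kC'; rewrite door adj => /esym lE.
    by case/negP: noA; apply/existsP; exists i; rewrite iC.
  move: door adj; rewrite tE DE => door adj.
  have := doorB y ys kC'; rewrite door adj => /esym/eqP lE.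
  have ly := sx y ys; rewrite lE in ly.
  have [lyC|lyC] := boolP (l y \in C); last first.
    by case/negP: noA; apply/existsP; exists (l y); rewrite lyC ly eqxx.
  have [lyk|lyk] := eqVneq (l y) k.
    by move: nrb; rewrite ly lyk setD1K ?eqxx.
  case/negP: nB; rewrite ly; apply/eqP/setUidPr.
  by rewrite sub1set !inE lyk.
have [kC'|kC'] := boolP (k \in C); last first.
  rewrite (_ : finset _ = set0) ?cards0//; apply/setP => d; rewrite !inE.
  by apply: contraNF kC' => /andP[]; apply: kC.
have cC : #|s| = #|C :\ k|.+1 by rewrite cs (cardsD1 k C) kC'.
have /dinjectivePn[x xs [x']] : ~~ dinjectiveb l s.
  apply/negP => /dinjectiveP inj.
  by have := card_in_imset inj; rewrite lE cC => /eqP; rewrite ltn_eqF.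
rewrite inE => /andP[x'x x's] lxx'.
have rm y z : y \in s -> z \in s -> y != z -> l y = l z -> l @: (s :\ y) = C :\ k.
  move=> ys zs yz lyz; rewrite -lE (sx y ys); apply/esym/setUidPr.
  by rewrite sub1set lyz imset_f// !inE zs eq_sym yz.
rewrite (_ : finset _ = [set (s :\ x, C); (s :\ x', C)]); last first.
  apply/setP => -[t D]; rewrite !inE; apply/idP/orP; last first.
    case=> /eqP ->; rewrite doorB//.
      by rewrite (rm x x')// eq_sym.
    by rewrite (rm x' x).
  move=> /andP[door adj].
  have [[tE [i iC DE]]|[DE [y ys tE]]] := door_adj_cases cell door adj.
    move: door adj; rewrite tE DE => door adj.
    have := doorA i iC kC'; rewrite door adj => /esym lE'.
    by case/negP: noA; apply/existsP; exists i; rewrite iC.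
  move: door adj; rewrite tE DE => door adj.
  have := doorB y ys kC'; rewrite door adj => /esym/eqP lE'.
  have [->|yx] := eqVneq y x; first by left.
  have [->|yx'] := eqVneq y x'; first by right.
  have : l @: (s :\ y :\ x) = C :\ k.
    have xsy : x \in s :\ y by rewrite !inE eq_sym yx.
    rewrite -lE' -{2}(setD1K xsy) imsetU1; apply/esym/setUidPr.
    by rewrite sub1set lxx' imset_f// !inE x'x x's eq_sym yx'.
  move=> /(congr1 (fun z : {set I} => #|z|)) h.
  have := leq_imset_card l (s :\ y :\ x); rewrite h.
  have := cardsD1 y s; rewrite ys cC; have := cardsD1 x (s :\ y).
  rewrite !inE xs eq_sym yx /= !add1n => -> -[->].
  by rewrite ltnn.
rewrite cards2; case: eqVneq => //= /(congr1 fst)/= /setP/(_ x').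
by rewrite !inE eqxx x'x x's.
Qed.

(* Parity count of incidences: a door with nonempty first component lies on two
   cells, the remaining door on one, and a cell that is not rainbow on an even
   number of doors. *)
Lemma rainbow_dominant (x0 : X) (k : I) :
  exists s C, [/\ s != set0, dominant s C & l @: s = C].
Proof.
suff /exists_inP[[s C] cell /eqP lE] :
    [exists c in scarf_cell, l @: c.1 == c.2].
  have /andP[/= doms /eqP cs] := cell; exists s, C; split=> //.
  apply/eqP => s0; have [i] := dominantP _ _ doms x0.
  by move: cs; rewrite s0 cards0 => /esym/cards0_eq ->; rewrite inE.
apply: contraT; rewrite negb_exists_in => /forall_inP nrb.
pose d0 : {set X} * {set I} := (set0, [set k]).
have door0 : scarf_door k d0.
  rewrite /scarf_door /d0 /= cards1 cards0 eqxx inE eqxx imset0 setDv eqxx.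
  by rewrite !andbT; apply/dominantP => y; exists k; rewrite ?inE// => x; rewrite inE.
have deg0 : odd #|[set c | scarf_cell c && scarf_adj c d0]|.
  (* A singleton is dominant for [k] alone only if its point is the top of the order [k]. *)
  have [xm _ xmax] := @arg_maxnP X x0 xpredT (r k) isT.
  rewrite (_ : finset _ = [set ([set xm], [set k])]) ?cards1//.
  apply/setP => -[s C]; rewrite !inE; apply/idP/eqP; last first.
    move=> ->; rewrite /scarf_cell /scarf_adj /= !cards1 eqxx sub0set subxx !andbT.
    apply/dominantP => y; exists k; rewrite ?inE// => x; rewrite inE => /eqP ->.
    exact: xmax.
  move=> /andP[/andP[/= doms /eqP cs] /andP[/= _]].
  rewrite subset1 => /orP[/eqP CE|/eqP C0]; last first.
    have [i] := dominantP _ _ doms x0.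
    by rewrite C0 inE.
  move: cs doms; rewrite CE cards1 => /eqP/cards1P[x ->] /dominantP/(_ xm)[i].
  rewrite inE => /eqP -> /(_ x); rewrite inE eqxx => /(_ isT) h.
  by rewrite (@r_inj k x xm)//; apply/eqP; rewrite eqn_leq h andbT; apply: xmax.
have degd d : scarf_door k d -> d != d0 ->
    ~~ odd #|[set c | scarf_cell c && scarf_adj c d]|.
  case: d => t D /and4P[/= domt /eqP cD kD /eqP lE].
  have [t0|/set0Pn[x xt]] := eqVneq t set0.
    move: lE; rewrite t0 imset0 => /esym/eqP; rewrite setD_eq0 => Dk.
    by rewrite xpair_eqE eqxx/= eqEsubset Dk sub1set kD.
  move=> _; have [c1 [c2 [c12 cE]]] := pivot xt domt cD.
  rewrite (_ : finset _ = [set c1; c2]) ?cards2 ?c12//.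
  by apply/setP => c; rewrite !inE cE.
have oddsum (T : finType) (P : pred T) F : (forall x, P x -> ~~ odd (F x)) ->
    ~~ odd (\sum_(x | P x) F x).
  by move=> h; elim/big_rec: _ => // x y Px; rewrite oddD (negPf (h x Px)).
have : odd (\sum_(d | scarf_door k d) #|[set c | scarf_cell c && scarf_adj c d]|).
  rewrite (bigD1 d0)//= oddD deg0 (negPf (oddsum _ _ _ _))// => d /andP[].
  exact: degd.
have -> : \sum_(d | scarf_door k d) #|[set c | scarf_cell c && scarf_adj c d]| =
    \sum_(c | scarf_cell c) #|[set d | scarf_door k d && scarf_adj c d]|.
  under eq_bigr do rewrite -sum1_card.
  under [RHS]eq_bigr do rewrite -sum1_card.
  rewrite (exchange_big_dep (fun c => scarf_cell c))/=.
    apply: eq_bigr => c cell; apply: eq_bigl => d.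
    by rewrite !inE cell.
  by move=> d c _; rewrite inE => /andP[].
rewrite (negPf (oddsum _ _ _ _))// => c cell; apply: even_doors => //.
exact: nrb.
Qed.
End Scarf.

From mathcomp Require Import all_order all_algebra.
From mathcomp Require Import all_classical all_reals all_analysis.
From mathcomp Require Import measurable_realfun zify ring lra.
Import Order.TTheory GRing.Theory Num.Theory.
Import numFieldNormedType.Exports.
Local Open Scope classical_set_scope.
Local Open Scope ring_scope.

(** * The Knaster-Kuratowski-Mazurkiewicz lemma *)

Section Grid.
Variables (n K : nat).
Hypothesis K0 : (0 < K)%N.

(** Points of the simplex with barycentric coordinates in multiples of [1/K], as a finite type on
    which Scarf's lemma applies. *)
Definition grid := {x : {ffun 'I_n.+1 -> 'I_K.+1} | (\sum_i x i == K)%N}.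

Definition grid_coord (x : grid) (i : 'I_n.+1) : nat := \val x i.

Lemma sum_grid x : (\sum_i grid_coord x i = K)%N.
Proof. exact/eqP/(valP x). Qed.

Lemma gridP (y : 'I_n.+1 -> nat) : (\sum_i y i = K)%N ->
  exists x : grid, forall i, grid_coord x i = y i.
Proof.
move=> sy; have le i : (y i < K.+1)%N by rewrite ltnS -sy (bigD1 i)//= leq_addr.
pose yf : {ffun 'I_n.+1 -> 'I_K.+1} := [ffun i => Ordinal (le i)].
have yK : (\sum_i yf i == K)%N.
  by apply/eqP; rewrite -[RHS]sy; apply: eq_bigr => i _; rewrite /yf ffunE.
by exists (exist _ yf yK) => i; rewrite /grid_coord /= ffunE.
Qed.

(** Order the grid by each coordinate. Dominance forces the coordinatewise minima over [C] to sum to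
    at least [K - n]; as every point has total [K], the points of [s] differ by at most [n] in each
    coordinate. *)
Lemma grid_rainbow (l : grid -> 'I_n.+1) : exists (p : grid) (C : {set 'I_n.+1}),
  (forall i, i \notin C -> (grid_coord p i <= n)%N) /\
  (forall i, i \in C -> exists2 q, l q = i &
     forall c, (grid_coord p c <= grid_coord q c + n)%N /\
               (grid_coord q c <= grid_coord p c + n)%N).
Proof.
pose M := #|{: grid}|.
(* The [i]-th coordinate decides, and the enumeration rank, smaller than [M], breaks ties. *)
pose r (i : 'I_n.+1) (x : grid) : nat := (grid_coord x i * M + enum_rank x)%N.
have rk (x : grid) : (enum_rank x < M)%N by exact: ltn_ord.
have M0 (x : grid) : (0 < M)%N by apply: leq_ltn_trans (rk x).
have rdiv i x : (r i x %/ M = grid_coord x i)%N.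
  by rewrite /r divnMDl ?(M0 x)// divn_small// addn0.
have r_inj i : injective (r i).
  move=> x y xy; have := congr1 (modn^~ M) xy.
  by rewrite /r !modnMDl !modn_small// => /val_inj/enum_rank_inj.
have r_le i x y : (r i y <= r i x)%N -> (grid_coord y i <= grid_coord x i)%N.
  by move=> h; rewrite -!rdiv leq_div2r.
have [x0 _] := @gridP (fun i => if i == ord0 then K else 0%N)
  ltac:(by rewrite -big_mkcond big_pred1_eq).
have [s [C [/set0Pn[p ps] dom lE]]] := @rainbow_dominant _ _ r l r_inj x0 ord0.
pose mu i := grid_coord (rmin_in r s p i) i.
have mu_le i x : x \in s -> (mu i <= grid_coord x i)%N.
  by move=> xs; apply: r_le; have [_] := rmin_inP r i ps; apply.
have [i0 i0C] : exists i, i \in C.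
  by exists (l p); rewrite -lE imset_f.
have cardC : (#|C| <= n.+1)%N by rewrite -[leqRHS]card_ord max_card.
have Smu : (K < \sum_(i in C) (mu i).+1)%N.
  rewrite ltnNge; apply/negP => h.
  set S := (\sum_(i in C) (mu i).+1)%N in h.
  (* Otherwise there is room for a grid point exceeding every minimum [mu i] on [C], the surplus
     [K - S] being put on [i0]; such a point contradicts dominance. *)
  have [|y yE] := @gridP (fun i => if i \in C then
     ((mu i).+1 + if i == i0 then K - S else 0)%N else 0%N).
    rewrite -big_mkcond/= big_split/= -big_mkcondr/= -/S.
    rewrite (@big_pred1 _ _ _ _ i0) ?subnKC// => i.
    by rewrite /=; case: eqVneq => [->|]; rewrite ?i0C ?andbF.
  have [i iC /(_ _ (proj1 (rmin_inP r i ps)))/r_le] := dominantP _ _ _ dom y.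
  by rewrite yE iC -/(mu i) leqNgt leq_addr.
rewrite (eq_bigr (fun i => mu i + 1)%N) in Smu; last by move=> i _; rewrite addn1.
rewrite big_split/= sum1_card in Smu.
have {}Smu : (K <= \sum_(i in C) mu i + n)%N.
  by rewrite -ltnS -addnS (leq_trans Smu)// leq_add2l.
have Sx x : (\sum_(i in C) grid_coord x i <= K)%N.
  by rewrite -(sum_grid x) [leqRHS](bigID (mem C))/= leq_addr.
have near x c : x \in s -> c \in C -> (grid_coord x c <= mu c + n)%N.
  move=> xs cC; have := leq_trans (Sx x) Smu; rewrite !(bigD1 c cC)/= addnAC => h.
  rewrite -(leq_add2r (\sum_(i in C | i != c) mu i)) (leq_trans _ h)// leq_add2l.
  by apply: leq_sum => i _; exact: mu_le.
have small x c : x \in s -> c \notin C -> (grid_coord x c <= n)%N.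
  move=> xs cC; have h : (\sum_(i in C) mu i <= \sum_(i in C) grid_coord x i)%N.
    by apply: leq_sum => i _; exact: mu_le.
  have e : (\sum_(i in C) grid_coord x i + grid_coord x c <= K)%N.
    rewrite -[leqRHS](sum_grid x) [leqRHS](bigID (mem C))/= leq_add2l.
    by rewrite [leqRHS](bigD1 c cC)/= leq_addr.
  rewrite -(leq_add2l (\sum_(i in C) mu i)) (leq_trans _ Smu)// (leq_trans _ e)//.
  by rewrite leq_add2r.
exists p, C; split=> [i|i]; first exact: small.
rewrite -{1}lE => /imsetP[q qs iE]; exists q => // c.
have [cC|cC] := boolP (c \in C).
  by have := near _ _ ps cC; have := near _ _ qs cC;
     have := mu_le c _ ps; have := mu_le c _ qs; lia.
by have := small _ _ ps cC; have := small _ _ qs cC; lia.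
Qed.

End Grid.

Lemma cvg_sumr (R : realType) (T : Type) (F : set_system T) {FF : Filter F}
    (W : normedModType R) (I : finType) (f : I -> T -> W) (l : I -> W) :
  (forall i, f i @ F --> l i) ->
  (fun x => \sum_i f i x) @ F --> \sum_i l i.
Proof.
move=> fl; apply: (@cvg_big _ _ +%R 0 xpredT _ _ _ _ f) => // x.
exact: add_continuous.
Qed.

Lemma harmonic_lt (R : realType) (e : R) : 0 < e ->
  exists N : nat, forall k, (N <= k)%N -> k.+1%:R^-1 < e.
Proof.
by move=> e0; have [N _ h] := near_infty_natSinv_lt (PosNum e0); exists N.
Qed.

Lemma closure_seq (R : realType) (X : normedModType R) (A : set X) x :
  closure A x -> exists2 y : nat -> X, (forall k, A (y k)) & y @ \oo --> x.
Proof.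
move=> clx; have /choice[y yP] k : exists y, A y /\ `|x - y| < k.+1%:R^-1.
  have [|y [Ay xy]] := clx (ball x k.+1%:R^-1); last first.
    by exists y; split => //; rewrite -ball_normE in xy.
  by apply: nbhsx_ballx; rewrite invr_gt0 ltr0Sn.
exists y; first by move=> k; case: (yP k).
apply/cvgrPdist_lt => e e0; have [N hN] := harmonic_lt e0.
exists N => // k /= Nk; exact: lt_trans (proj2 (yP k)) (hN _ Nk).
Qed.

Section Simplex.
Variables (R : realType) (n : nat).

Definition simplex : set 'rV[R]_n.+1 :=
  [set p | (forall i, 0 <= p ord0 i) /\ \sum_i p ord0 i = 1].

Lemma simplex_le1 p i : simplex p -> p ord0 i <= 1.
Proof.
by move=> [p0 <-]; rewrite (bigD1 i)//= lerDl sumr_ge0.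
Qed.

Lemma closed_simplex : closed simplex.
Proof.
rewrite (_ : simplex = (\bigcap_i [set p | 0 <= p ord0 i]) `&`
   (fun p => \sum_i p ord0 i) @^-1` [set 1]); last first.
  apply/seteqP; split => p [p0 p1]; split => //.
    by move=> i _; exact: p0.
  by move=> i; exact: p0.
apply: closedI.
  apply: closed_bigI => i _.
  apply: (@closed_comp _ _ (fun p : 'rV[R]_n.+1 => p ord0 i) [set x | 0 <= x]).
    by move=> p _; apply: coord_continuous.
  exact: closed_ge.
apply: closed_comp; last exact: closed_eq.
move=> p _; apply: (@cvg_sumr _ _ (nbhs p)) => i; exact: coord_continuous.
Qed.

Lemma ler_row_norm (x : 'rV[R]_n.+1) e : 0 <= e ->
  (forall i, `|x ord0 i| <= e) -> `|x| <= e.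
Proof.
move=> e0 h; rewrite [leLHS]/Num.norm /= mx_normrE; apply/bigmax_leP; split => // -[i j] _ /=.
by rewrite (ord1 i).
Qed.

Lemma ler_coord_norm (x : 'rV[R]_n.+1) i : `|x ord0 i| <= `|x|.
Proof.
rewrite [leRHS]/Num.norm /= mx_normrE; apply/bigmax_geP; right.
by exists (ord0, i).
Qed.

Lemma compact_simplex : compact simplex.
Proof.
apply: bounded_closed_compact; last exact: closed_simplex.
exists 1; split => // M M1 p sp; apply: ler_row_norm => [|i].
  by rewrite (le_trans _ (ltW M1)).
by rewrite ger0_norm ?(proj1 sp)// (le_trans (simplex_le1 i sp))// ltW.
Qed.

(* Brouwer's theorem in the form that the labels of a closed cover pick out the
   support of some point. *)
Lemma closed_cover_simplex (F : 'I_n.+1 -> set 'rV[R]_n.+1) :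
  (forall i, closed (F i)) -> (forall p, simplex p -> exists i, F i p) ->
  exists2 p, simplex p & forall i, 0 < p ord0 i -> F i p.
Proof.
move=> clF covF.
(* The tolerance is the grid slack [n] divided by the mesh size [K = k.+1]. *)
have /choice[p pP] k : exists p, simplex p /\ forall i, p ord0 i <= n%:R / k.+1%:R \/
    exists2 q, F i q & `|q - p| <= n%:R / k.+1%:R.
  pose K := k.+1; pose pt (x : grid n K) : 'rV[R]_n.+1 :=
    \row_i ((grid_coord x i)%:R / K%:R).
  have spt x : simplex (pt x).
    split=> [i|]; first by rewrite mxE divr_ge0.
    rewrite (eq_bigr (fun i => (grid_coord x i)%:R / K%:R)); last first.
      by move=> i _; rewrite mxE.
    by rewrite -mulr_suml -natr_sum sum_grid divff ?pnatr_eq0.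
  have /choice[l lP] x := covF (pt x) (spt x).
  have [x [C [xC qC]]] := grid_rainbow (ltn0Sn k) l.
  exists (pt x); split => // i; have [iC|iC] := boolP (i \in C).
    right; have [q lq qx] := qC i iC; exists (pt q); first by rewrite -lq.
    apply: ler_row_norm => [|c]; first by rewrite divr_ge0.
    rewrite !mxE -mulrBl normrM (@gtr0_norm _ k.+1%:R^-1) ?invr_gt0 ?ltr0Sn//.
    rewrite ler_wpM2r ?invr_ge0// ler_distl.
    have [h1 h2] := qx c.
    by rewrite lerBlDr -!natrD !ler_nat h1 h2.
  by left; rewrite mxE ler_wpM2r ?invr_ge0// ler_nat xC.
have [|a [sa ca]] := @compact_simplex (p @ \oo) _.
  by exists 0%N => // k _ /=; case: (pP k).
exists a => // i ai0; apply: clF => B /nbhs_ballP[e /= e0 eB].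
(* The second half keeps [p k ord0 i] above the tolerance, which rules out the small-coordinate
   alternative; the first half keeps the labelled point [q] within [e] of [a]. *)
pose d := Num.min (e / 2) (a ord0 i / 2).
have d0 : 0 < d by rewrite lt_min !divr_gt0.
have [N hN] : exists N : nat, forall k, (N <= k)%N -> n%:R / k.+1%:R < d.
  have [N hN] := @harmonic_lt R (d / n.+1%:R) ltac:(by rewrite divr_gt0).
  exists N => k /hN; rewrite ltr_pdivlMr// mulrC; apply: le_lt_trans.
  by rewrite ler_wpM2r ?invr_ge0// ler_nat.
have [||_ [[k /= Nk <-]]] := ca [set p k | k in [set k | (N <= k)%N]] (ball a d).
- by exists N => // k /= Nk; exists k.
- exact: nbhsx_ballx.
rewrite -ball_normE /= => apk; have [sp /(_ i)[h|[q Fq qp]]] := pP k.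
  have : a ord0 i - p k ord0 i < a ord0 i / 2.
    have := le_lt_trans (ler_coord_norm (a - p k) i) apk.
    by rewrite !mxE /d lt_min => /andP[_]; apply: le_lt_trans; exact: ler_norm.
  have := le_lt_trans h (hN _ Nk); rewrite /d lt_min => /andP[_ ].
  lra.
exists q; split => //; apply: eB; rewrite -ball_normE /=.
have -> : a - q = (a - p k) - (q - p k) by rewrite opprB addrA subrK.
rewrite (le_lt_trans (ler_normB _ _))//.
have := le_lt_trans qp (hN _ Nk); move: apk; rewrite /d !lt_min.
move=> /andP[? _] /andP[? _]; lra.
Qed.

Definition setdist (G : set 'rV[R]_n.+1) (x : 'rV[R]_n.+1) : R :=
  inf [set `|x - y| | y in G].

Lemma setdist_has_inf (G : set 'rV[R]_n.+1) x : G !=set0 -> has_inf [set `|x - y| | y in G].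
Proof.
by move=> [y Gy]; split; [exists `|x - y|, y|exists 0 => _ [z _ <-]].
Qed.

Lemma setdist_ge0 G x : G !=set0 -> 0 <= setdist G x.
Proof.
move=> [y Gy]; apply: lb_le_inf; first by exists `|x - y|, y.
by move=> _ [z _ <-].
Qed.

Lemma setdist_lip G x y : G !=set0 -> setdist G x <= setdist G y + `|x - y|.
Proof.
move=> G0; rewrite -lerBlDr; apply: lb_le_inf; first by case: G0 => z Gz; exists `|y - z|, z.
move=> _ [z Gz <-]; rewrite lerBlDr.
apply: le_trans (_ : `|x - z| <= _).
  by apply: ge_inf; [case: (setdist_has_inf x G0)|exists z].
by rewrite [leRHS]addrC (le_trans _ (ler_normD _ _))// addrA subrK.
Qed.

Lemma setdist_continuous G : G !=set0 -> continuous (setdist G).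
Proof.
move=> G0 x; apply/(@cvgrPdist_lt _ _ _ (nbhs x)) => e e0.
apply/nbhs_ballP; exists e => //= y; rewrite -ball_normE /= => xy.
rewrite (le_lt_trans _ xy)// ler_distl; apply/andP; split.
  by rewrite lerBlDr distrC setdist_lip.
exact: setdist_lip.
Qed.

Lemma setdist0 G x : closed G -> G !=set0 -> setdist G x = 0 -> G x.
Proof.
move=> clG G0 dx; apply: clG => B /nbhs_ballP[e /= e0 eB].
have [|_ [y Gy <-] xy] := @inf_lt _ _ e (proj1 (setdist_has_inf x G0)).
  by rewrite -/(setdist G x) dx.
by exists y; split => //; apply: eB; rewrite -ball_normE.
Qed.

Lemma setdist_eq0 G x : G x -> setdist G x = 0.
Proof.
move=> Gx; have G0 : G !=set0 by exists x.
apply/eqP; rewrite eq_le setdist_ge0// andbT.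
apply: ge_inf; first by case: (setdist_has_inf x G0).
by exists x => //; rewrite subrr normr0.
Qed.

(* Knaster-Kuratowski-Mazurkiewicz: cover the simplex by the sets where the
   distance to G_i exceeds the i-th barycentric share of all distances. *)
Lemma KKM (G : 'I_n.+1 -> set 'rV[R]_n.+1) :
  (forall i, closed (G i)) ->
  (forall p, simplex p -> exists2 i, 0 < p ord0 i & G i p) ->
  exists2 p, simplex p & forall i, G i p.
Proof.
move=> clG kkm.
have sv i : simplex (delta_mx ord0 i : 'rV[R]_n.+1).
  split=> [j|]; first by rewrite mxE ler0n.
  rewrite (bigD1 i)//= mxE !eqxx big1 ?addr0// => j ji.
  by rewrite mxE (negPf ji).
have G0 i : G i !=set0.
  have [j] := kkm _ (sv i); rewrite mxE eqxx /=.
  by case: eqVneq => [->|]; [exists (delta_mx ord0 i)|rewrite ltxx].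
pose D x := \sum_i setdist (G i) x.
have D0 x : 0 <= D x by apply: sumr_ge0 => i _; exact: setdist_ge0.
have [||p sp pP] := @closed_cover_simplex
    (fun i => [set x | 0 <= setdist (G i) x - x ord0 i * D x]).
- move=> i; apply: (@closed_comp _ _
    (fun x : 'rV[R]_n.+1 => setdist (G i) x - x ord0 i * D x) [set x | 0 <= x]).
    move=> x _; apply: (@cvgB _ _ _ (nbhs x)).
      exact: (setdist_continuous (G0 i)).
    apply: (@cvgM _ _ (nbhs x)); first exact: coord_continuous.
    apply: (@cvg_sumr _ _ (nbhs x)) => j.
    exact: (setdist_continuous (G0 j)).
  exact: closed_ge.
(* The differences sum to zero because the coordinates sum to one, so they cannot all be
   negative. *)
- move=> x [x0 x1]; apply: contrapT => /forallNP h.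
  have : \sum_i (setdist (G i) x - x ord0 i * D x) < 0.
    rewrite (bigD1 ord0)//= -[ltRHS]addr0 ltr_leD//.
      by rewrite ltNge; apply/negP/h.
    by apply: sumr_le0 => i _; rewrite leNgt; apply/negP => /ltW /h.
  by rewrite sumrB -mulr_suml x1 mul1r subrr ltxx.
exists p => //; have [i pi Gip] := kkm p sp.
(* At an index with [p ord0 i > 0] and [G i p], the distance vanishes, so the share of [D p] is
   nonpositive. *)
have Dp : D p = 0.
  apply/eqP; rewrite eq_le D0 andbT.
  by have := pP i pi; rewrite /= (setdist_eq0 Gip) sub0r oppr_ge0 pmulr_rle0.
move=> j; apply: setdist0 => //; apply/eqP; move/eqP: Dp.
rewrite psumr_eq0; last by move=> k _; exact: setdist_ge0.
by move=> /allP/(_ j); rewrite mem_index_enum => /(_ isT).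
Qed.

End Simplex.

(** * Hahn-Banach theorem *)

Section LinearMaps.
Variables (R : realType) (V W : lmodType R) (f : V -> W).
Hypothesis flin : forall a x y, f (a *: x + y) = a *: f x + f y.

Lemma lmapD x y : f (x + y) = f x + f y.
Proof. by have := flin 1 x y; rewrite !scale1r. Qed.

Lemma lmap0 : f 0 = 0.
Proof. by apply: (@addrI _ (f 0)); rewrite -lmapD !addr0. Qed.

Lemma lmapZ a x : f (a *: x) = a *: f x.
Proof. by have := flin a x 0; rewrite lmap0 !addr0. Qed.

Lemma lmapN x : f (- x) = - f x.
Proof. by rewrite -scaleN1r lmapZ scaleN1r. Qed.

Lemma lmapB x y : f (x - y) = f x - f y.
Proof. by rewrite lmapD lmapN. Qed.

End LinearMaps.

Section LinearForms.
Variables (R : realType) (V : lmodType R) (g : V -> R).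
Hypothesis glin : forall a x y, g (a *: x + y) = a * g x + g y.

Lemma lformD x y : g (x + y) = g x + g y.
Proof. exact: (@lmapD _ _ R^o g glin). Qed.

Lemma lform0 : g 0 = 0.
Proof. exact: (@lmap0 _ _ R^o g glin). Qed.

Lemma lformZ a x : g (a *: x) = a * g x.
Proof. exact: (@lmapZ _ _ R^o g glin). Qed.

Lemma lformN x : g (- x) = - g x.
Proof. exact: (@lmapN _ _ R^o g glin). Qed.

Lemma lformB x y : g (x - y) = g x - g y.
Proof. exact: (@lmapB _ _ R^o g glin). Qed.

End LinearForms.

Section HahnBanach.
Variables (R : realType) (U : lmodType R).

(** Homogeneity is only asked as an inequality, which is easier to check for infima; equality
    follows by rescaling with [t^-1]. *)
Definition sublinear (p : U -> R) :=
  (forall x y, p (x + y) <= p x + p y) /\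
  (forall t x, 0 < t -> p (t *: x) <= t * p x).

Lemma sublinearZ p t x : sublinear p -> 0 < t -> p (t *: x) = t * p x.
Proof.
move=> [_ pZ] t0; apply/eqP; rewrite eq_le pZ//=.
have := pZ t^-1 (t *: x); rewrite scalerA mulVf ?gt_eqF// scale1r invr_gt0.
by move=> /(_ t0); rewrite ler_pdivlMl.
Qed.

Lemma sublinear0 p : sublinear p -> p 0 = 0.
Proof.
move=> sp; have := @sublinearZ p 2 0 sp ltac:(by []).
by rewrite scaler0; lra.
Qed.

Lemma sublinearN p x : sublinear p -> - p (- x) <= p x.
Proof.
move=> sp; have := proj1 sp x (- x); rewrite subrr sublinear0//.
by lra.
Qed.

(** Common source of the infimum over a chain in Zorn's lemma and of the infimum over a cone; the
    minorant [m] makes each real infimum meaningful. *)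
Lemma inf_sublinear (I : Type) (D : set I) (F : I -> U -> R) (m : U -> R) :
  D !=set0 -> (forall i x, D i -> m x <= F i x) ->
  (forall i j x y, D i -> D j -> exists2 k, D k & F k (x + y) <= F i x + F j y) ->
  (forall i t x, 0 < t -> D i -> exists2 k, D k & F k (t *: x) <= t * F i x) ->
  sublinear (fun x => inf [set F i x | i in D]) /\
  (forall i x, D i -> inf [set F i x | i in D] <= F i x).
Proof.
move=> [i0 Di0] lbm FD FZ.
have le i x : D i -> inf [set F i x | i in D] <= F i x.
  by move=> Di; apply: ge_inf; [exists (m x) => _ [j Dj <-]; exact: lbm|exists i].
have ge c x : (forall i, D i -> c <= F i x) -> c <= inf [set F i x | i in D].
  by move=> h; apply: lb_le_inf; [exists (F i0 x), i0|move=> _ [j Dj <-]; exact: h].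
split=> //; split=> [x y|t x t0].
  rewrite /= -lerBlDr; apply: (ge) => i Di; rewrite lerBlDl -lerBlDr.
  apply: (ge) => j Dj; rewrite lerBlDr [leRHS]addrC.
  by have [k Dk h] := FD i j x y Di Dj; rewrite (le_trans (le k _ Dk)).
rewrite /= -ler_pdivrMl//; apply: (ge) => i Di; rewrite ler_pdivrMl//.
by have [k Dk h] := FZ i t x t0 Di; rewrite (le_trans (le k _ Dk)).
Qed.

(** The pairs [(c i, r i)] form a cone under the graph of [p]. The new functional satisfies
    [q (- c i) <= - r i], so a linear form below it is at least [r i] at [c i]. A ray and the graph
    of a linear form are the two cones used. *)
Lemma cone_inf_sublinear (p : U -> R) (I : Type) (D : set I) (c : I -> U) (r : I -> R) :
  sublinear p -> D !=set0 ->
  (forall i j, D i -> D j -> exists2 k, D k & c k = c i + c j /\ r k = r i + r j) ->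
  (forall t i, 0 < t -> D i -> exists2 k, D k & c k = t *: c i /\ r k = t * r i) ->
  (forall i, D i -> r i <= p (c i)) ->
  exists q, sublinear q /\ forall i x, D i -> q x <= p (x + c i) - r i.
Proof.
move=> sp D0 DD DZ rp.
have [] := @inf_sublinear I D (fun i x => p (x + c i) - r i) (fun x => - p (- x)) D0.
- move=> i x Di; have := proj1 sp (- x) (x + c i); rewrite addKr.
  by have := rp i Di; lra.
- move=> i j x y Di Dj; have [k Dk [ck rk]] := DD i j Di Dj; exists k => //=.
  by rewrite ck rk addrACA; have := proj1 sp (x + c i) (y + c j); lra.
- move=> i t x t0 Di; have [k Dk [ck rk]] := DZ t i t0 Di; exists k => //=.
  by rewrite ck rk -scalerDr sublinearZ// mulrBr.
by move=> sq qle; eexists; split; [exact: sq|exact: qle].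
Qed.

Lemma exists_min_sublinear (p : U -> R) : sublinear p ->
  exists q, [/\ sublinear q, (forall x, q x <= p x) &
    forall q', sublinear q' -> (forall x, q' x <= q x) -> forall x, q x <= q' x].
Proof.
move=> sp; pose T := {q : U -> R | sublinear q /\ forall x, q x <= p x}.
(* The order is reversed, so that Zorn's maximal element is a minimal functional. *)
pose leT (s t : T) := `[< forall x, sval t x <= sval s x >].
pose t0 : T := exist _ p (conj sp (fun x => lexx (p x))).
have [| | |[q [sq qp]] qmax] := @ZL_preorder T t0 leT.
- by move=> t; apply/asboolP => x.
- move=> r s t /asboolP rs /asboolP st; apply/asboolP => x.
  exact: le_trans (st x) (rs x).
- move=> D totD; have [D0|D0] := pselect (D !=set0); last first.
    by exists t0 => s Ds; case: D0; exists s.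
  have [] := @inf_sublinear T D sval (fun x => - p (- x)) D0.
  + move=> [q [sq qp]] x _ /=; apply: le_trans (sublinearN x sq).
    by rewrite lerN2.
  + move=> i j x y Di Dj; have [/asboolP ij|/asboolP ji] := totD i j Di Dj.
      by exists j => //; rewrite (le_trans (proj1 (proj1 (svalP j)) x y))// lerD2r.
    by exists i => //; rewrite (le_trans (proj1 (proj1 (svalP i)) x y))// lerD2l.
  + by move=> i t x t0' Di; exists i => //; exact: (proj2 (proj1 (svalP i))).
  move=> sq qle; have [d Dd] := D0.
  have qp x : inf [set sval i x | i in D] <= p x.
    exact: le_trans (qle d x Dd) (proj2 (svalP d) x).
  exists (exist (fun q => sublinear q /\ forall x, q x <= p x) _ (conj sq qp)).
  move=> s Ds; apply/asboolP => x /=.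
  exact: qle.
exists q; split=> // q' sq' q'q.
have q'p x : q' x <= p x by exact: le_trans (q'q x) (qp x).
have := qmax (exist (fun q => sublinear q /\ forall x, q x <= p x) q' (conj sq' q'p))
  ltac:(exact/asboolP).
by move=> /asboolP.
Qed.

(* A minimal sublinear functional is linear: lowering it along the ray through
   [x] by the largest admissible amount forces [q (- x) <= - q x]. *)
Lemma linear_below_sublinear (p : U -> R) : sublinear p ->
  exists2 g : U -> R, (forall a x y, g (a *: x + y) = a * g x + g y) &
    forall x, g x <= p x.
Proof.
move=> /exists_min_sublinear[q [sq qp qmin]]; exists q => //.
have qN x : q (- x) = - q x.
  apply/eqP; rewrite eq_le -[X in _ && X]lerN2 opprK sublinearN// andbT.
  have [||||q' [sq' q'le]] := @cone_inf_sublinear q R [set t | 0 <= t]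
      (fun t => t *: x) (fun t => t * q x) sq.
  - by exists 0 => /=.
  - move=> s t /= s0 t0; exists (s + t); first exact: addr_ge0.
    by rewrite scalerDl mulrDl.
  - move=> s t /= s0 t0; exists (s * t); first by rewrite mulr_ge0// ltW.
    by rewrite scalerA mulrA.
  - move=> t /=; rewrite le_eqVlt => /orP[/eqP<-|t0].
      by rewrite scale0r mul0r sublinear0.
    by rewrite sublinearZ.
  have q'q y : q' y <= q y.
    by have := q'le 0 y; rewrite /= lexx scale0r mul0r addr0 subr0; apply.
  have := q'le 1 (- x); rewrite /= ler01 scale1r mul1r addNr sublinear0//.
  by move=> /(_ isT); rewrite sub0r; apply: le_trans; exact: qmin.
have qD x y : q (x + y) = q x + q y.
  apply/eqP; rewrite eq_le (proj1 sq)/=.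
  by have := proj1 sq (x + y) (- y); rewrite addrK qN; lra.
move=> a x y; rewrite qD; congr (_ + _).
have [a0|a0|<-] := ltgtP 0 a.
- exact: sublinearZ.
- have := @sublinearZ q (- a) x sq; rewrite oppr_gt0 scaleNr qN mulNr.
  by move=> /(_ a0)/oppr_inj.
- by rewrite scale0r mul0r sublinear0.
Qed.

(** The map [i] may have a kernel: domination at [v] and [- v] makes [l] vanish there. The cone is
    the graph of [l] over [i], and the resulting inequality [l v <= g (i v)] becomes an equality on
    replacing [v] by [- v]. *)
Lemma hahn_banach (V : lmodType R) (p : U -> R) (i : V -> U) (l : V -> R) :
  sublinear p -> (forall a x y, i (a *: x + y) = a *: i x + i y) ->
  (forall a x y, l (a *: x + y) = a * l x + l y) ->
  (forall v, l v <= p (i v)) ->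
  exists g : U -> R, [/\ forall a x y, g (a *: x + y) = a * g x + g y,
    forall x, g x <= p x & forall v, g (i v) = l v].
Proof.
move=> sp ilin llin lp.
have i0 := lmap0 ilin; have l0 := lform0 llin.
have [||||q [sq qle]] := @cone_inf_sublinear p V setT i l sp.
- by exists 0.
- move=> x y _ _; exists (x + y) => //.
  by rewrite (lmapD ilin) (lformD llin).
- by move=> t x _ _; exists (t *: x) => //; rewrite (lmapZ ilin) (lformZ llin).
- by [].
have [g glin gq] := linear_below_sublinear sq.
have gN := lformN glin.
have gi v : l v <= g (i v).
  have := le_trans (gq (- i v)) (qle v (- i v) I).
  by rewrite addNr gN sublinear0// sub0r lerN2.
exists g; split=> // [x|v].
  by apply: le_trans (gq x) _; have := qle 0 x I; rewrite i0 l0 addr0 subr0.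
apply/eqP; rewrite eq_le gi andbT.
by have := gi (- v); rewrite (lmapN ilin) (lformN llin) gN lerN2.
Qed.

End HahnBanach.

(** * Clarke's directional derivative *)

Section Clarke.
Variables (R : realType) (U : completeNormedModType R) (J : U -> R).
Hypothesis Jlip : loc_lipschitz J.

Definition diff_quot (y v : U) (lam : R) := (J (y + lam *: v) - J y) / lam.

Definition clarke (x v : U) : R := fine (clarke_dd J x v).

Lemma clarke_dd_le (x v : U) (c d : R) : 0 < d ->
  (forall y lam, `|y - x| < d -> 0 < lam < d -> diff_quot y v lam <= c) ->
  (clarke_dd J x v <= c%:E)%E.
Proof.
move=> d0 h; apply: ereal_inf_le; exists (ereal_sup [set z : \bar R |
   exists (y : U) (lam : R), `|y - x| < d /\ 0 < lam < d /\
         z = ((J (y + lam *: v) - J y) / lam)%:E]); first by exists d.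
by apply: ge_ereal_sup => _ [y [lam [yx [lamd ->]]]]; rewrite lee_fin h.
Qed.

(** The constant [L] is uniform in the direction and in nearby base points; only the radius [d]
    depends on [v]. The radii [r/2], [r/4], [r/4] keep [y + lam *: v] in the ball where [J] is
    Lipschitz. *)
Lemma diff_quot_bound (x : U) : exists r : R, 0 < r /\ exists L : R, 0 <= L /\
  forall x' v, `|x' - x| < r -> exists d : R, 0 < d /\
    forall y lam, `|y - x'| < d -> 0 < lam < d -> `|diff_quot y v lam| <= L * `|v|.
Proof.
have [r [r0 [L hL]]] := Jlip x; exists (r / 2); split; first exact: divr_gt0.
exists (Num.max L 0); split; first by rewrite le_max lexx orbT.
move=> x' v x'x; exists (r / 4 / (1 + `|v|)).
have v0 : 0 < 1 + `|v| by rewrite ltr_pwDl.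
split; first by rewrite !divr_gt0.
move=> y lam; rewrite !(ltr_pdivlMr _ _ v0) => yx' /andP[lam0 lamd].
have yx'2 : `|y - x'| < r / 4.
  by apply: le_lt_trans yx'; rewrite ler_peMr// lerDl.
have lamv : lam * `|v| < r / 4.
  by apply: le_lt_trans lamd; rewrite (ler_wpM2l (ltW lam0))// lerDr.
have yx : `|y - x| < r.
  rewrite (_ : y - x = (y - x') + (x' - x)); last by rewrite addrA subrK.
  by rewrite (le_lt_trans (ler_normD _ _))//; lra.
have yvx : `|y + lam *: v - x| < r.
  rewrite (_ : y + lam *: v - x = (y - x') + lam *: v + (x' - x)); last first.
    by rewrite [RHS]addrAC addrA subrK addrAC.
  have := ler_normD (y - x' + lam *: v) (x' - x).
  by have := ler_normD (y - x') (lam *: v); rewrite normrZ gtr0_norm//; lra.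
rewrite normrM normfV (gtr0_norm lam0) ler_pdivrMr//.
have := hL (y + lam *: v) y yvx yx; rewrite addrAC subrr add0r normrZ gtr0_norm//.
move=> /le_trans; apply; rewrite mulrCA [leRHS]mulrC (ler_wpM2l (ltW lam0))//.
by rewrite ler_wpM2r// le_max lexx.
Qed.

Lemma clarke_fin x v : clarke_dd J x v \is a fin_num.
Proof.
have [r [r0 [L [L0 /(_ x v)]]]] := diff_quot_bound x.
rewrite subrr normr0 => /(_ r0)[d [d0 hd]].
have le : (clarke_dd J x v <= (L * `|v|)%:E)%E.
  by apply: (clarke_dd_le d0) => y lam yx lamd; exact: le_trans (ler_norm _) (hd _ _ yx lamd).
have ge : ((- (L * `|v|))%:E <= clarke_dd J x v)%E.
  apply: le_ereal_inf_tmp => _ [e /= e0 <-].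
  pose lam := Num.min d e / 2.
  have m0 : 0 < Num.min d e by rewrite lt_min d0.
  have lam0 : 0 < lam by rewrite divr_gt0.
  have lamm : lam < Num.min d e by rewrite /lam; lra.
  have [lamd lame] : lam < d /\ lam < e by move: lamm; rewrite lt_min => /andP[].
  apply: le_trans (_ : (diff_quot x v lam)%:E <= _)%E.
    rewrite lee_fin; have := hd x lam; rewrite subrr normr0 d0 lam0 lamd.
    by move=> /(_ isT isT); rewrite ler_norml => /andP[].
  apply: ereal_sup_ubound; exists x, lam.
  by rewrite subrr normr0 e0 lam0 lame.
by rewrite fin_numElt (lt_le_trans (ltNyr _) ge) (le_lt_trans le (ltry _)).
Qed.

Lemma clarkeE x v : clarke_dd J x v = (clarke x v)%:E.
Proof. by rewrite /clarke fineK ?clarke_fin. Qed.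

Lemma clarke_le x v c d : 0 < d ->
  (forall y lam, `|y - x| < d -> 0 < lam < d -> diff_quot y v lam <= c) ->
  clarke x v <= c.
Proof. by move=> d0 h; rewrite -lee_fin -clarkeE; exact: clarke_dd_le h. Qed.

Lemma diff_quot_lt_clarke x v e : 0 < e -> exists2 d : R, 0 < d &
  forall y lam, `|y - x| < d -> 0 < lam < d -> diff_quot y v lam < clarke x v + e.
Proof.
move=> e0; have : (clarke_dd J x v < (clarke x v + e)%:E)%E.
  by rewrite clarkeE lte_fin ltrDl.
move=> /ereal_inf_lt[_ [d /= d0 <-] h]; exists d => // y lam yx lamd.
rewrite -lte_fin; apply: le_lt_trans h; apply: ereal_sup_ubound.
by exists y, lam.
Qed.

Lemma clarke_lip x : exists r : R, 0 < r /\ exists L : R, 0 <= L /\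
  forall x' v, `|x' - x| < r -> clarke x' v <= L * `|v|.
Proof.
have [r [r0 [L [L0 h]]]] := diff_quot_bound x; exists r; split=> //; exists L.
split=> // x' v /(h x' v)[d [d0 hd]]; apply: (clarke_le d0) => y lam yx lamd.
exact: le_trans (ler_norm _) (hd _ _ yx lamd).
Qed.

(** The quotient in direction [v + w] splits into one in direction [w] at [y] and one in direction
    [v] at [y + lam *: w], still near [x]. A factor [t] on the direction is absorbed by using the
    step [t * lam]. *)
Lemma clarke_sublinear x : sublinear (clarke x).
Proof.
split=> [v w|t v t0].
  apply/ler_addgt0Pr => e e0; have e20 : 0 < e / 2 by rewrite divr_gt0.
  have [d1 d10 h1] := diff_quot_lt_clarke x v e20.
  have [d2 d20 h2] := diff_quot_lt_clarke x w e20.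
  pose k := 1 + `|w|; have k0 : 0 < k by rewrite ltr_pwDl.
  pose m := Num.min d1 d2; have m0 : 0 < m by rewrite lt_min d10.
  have [md1 md2] : m <= d1 /\ m <= d2.
    by rewrite /m !ge_min !lexx orbT.
  pose d := m / 2 / k; have d0 : 0 < d by rewrite !divr_gt0.
  have dm : d <= m / 2.
    by rewrite ler_pdivrMr// ler_peMr ?lerDl// divr_ge0// ltW.
  apply: (clarke_le d0) => y lam yx /andP[lam0 lamd].
  have lamw : lam * `|w| <= m / 2.
    apply: le_trans (_ : lam * k <= _); first by rewrite (ler_wpM2l (ltW lam0))// lerDr.
    by rewrite -ler_pdivlMr// ltW.
  have -> : diff_quot y (v + w) lam = diff_quot (y + lam *: w) v lam + diff_quot y w lam.
    rewrite /diff_quot -mulrDl scalerDr addrA addrAC [in RHS]addrA.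
    by rewrite subrK.
  have ywx : `|y + lam *: w - x| < d1.
    rewrite addrAC (le_lt_trans (ler_normD _ _))// normrZ gtr0_norm//; lra.
  have := h1 (y + lam *: w) lam ywx; have := h2 y lam; rewrite lam0 /=.
  move=> /(_ ltac:(lra) ltac:(lra)) ? /(_ ltac:(lra)); lra.
rewrite -ler_pdivrMl//; apply/ler_addgt0Pr => e e0; rewrite ler_pdivrMl//.
have [d d0 h] := diff_quot_lt_clarke x v e0.
pose k := 1 + t; have k0 : 0 < k by rewrite ltr_pwDl// ltW.
have dk0 : 0 < d / k by rewrite divr_gt0.
apply: (clarke_le dk0) => y lam yx /andP[lam0 lamd].
have dkd : d / k <= d by rewrite ler_pdivrMr// (ler_peMr (ltW d0))// lerDl ltW.
have tl : t * lam < d.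
  move: lamd; rewrite ltr_pdivlMr// mulrC; apply: le_lt_trans.
  by rewrite (ler_wpM2r (ltW lam0))// lerDr.
have -> : diff_quot y (t *: v) lam = t * diff_quot y v (t * lam).
  rewrite /diff_quot scalerA [lam * t]mulrC invfM [RHS]mulrCA mulrA.
  by rewrite mulrC -!mulrA [X in _ = _ * X]mulrA mulfV ?gt_eqF// mul1r mulrC.
rewrite ler_wpM2l ?(ltW t0)// ltW// h ?(lt_le_trans yx)// tl andbT.
exact: mulr_gt0.
Qed.

(** Moving the base point only shrinks the neighbourhood in the upper limit; moving the direction
    costs at most [L * |v' - v|] by subadditivity. *)
Lemma clarke_usc x v e : 0 < e -> exists2 d : R, 0 < d &
  forall x' v', `|x' - x| < d -> `|v' - v| < d -> clarke x' v' <= clarke x v + e.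
Proof.
move=> e0; have [r [r0 [L [L0 hL]]]] := clarke_lip x.
have e20 : 0 < e / 2 by rewrite divr_gt0.
have [d d0 h] := diff_quot_lt_clarke x v e20.
pose m := Num.min r (Num.min (d / 2) (e / 2 / (L + 1))).
have L10 : 0 < L + 1 by rewrite ltr_wpDl.
exists m => [|x' v']; rewrite !lt_min.
  by rewrite r0 divr_gt0//= !divr_gt0.
move=> /and3P[x'r x'd _] /and3P[_ _]; rewrite ltr_pdivlMr// => v'v.
have hv : clarke x' v <= clarke x v + e / 2.
  apply: (@clarke_le _ _ _ (d / 2)) => [|y lam yx /andP[lam0 lamd]].
    by rewrite divr_gt0.
  apply/ltW/h; last by rewrite lam0/=; lra.
  rewrite (_ : y - x = (y - x') + (x' - x)); last by rewrite addrA subrK.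
  by have := ler_normD (y - x') (x' - x); lra.
have := proj1 (clarke_sublinear x') v (v' - v); rewrite addrC subrK.
have := hL x' (v' - v) x'r.
have : L * `|v' - v| <= e / 2.
  apply: le_trans (ltW v'v); rewrite mulrC ler_wpM2l// lerDl//.
lra.
Qed.

(** Continuity comes for free: [J0 (x; .)] is bounded by [L] times the norm, and linearity turns
    this into a two-sided bound. *)
Lemma clarke_subdiff_of_le x (xi : U -> R) :
  (forall a y z, xi (a *: y + z) = a * xi y + xi z) ->
  (forall v, xi v <= clarke x v) -> clarke_subdiff J x xi.
Proof.
move=> xilin xile; split; last by move=> v; rewrite clarkeE lee_fin.
split=> // y; have [r [r0 [L [L0 hL]]]] := clarke_lip x.
have bnd v : `|xi v| <= L * `|v|.
  have h w : xi w <= L * `|w|.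
    by apply: le_trans (xile w) (hL _ _ _); rewrite subrr normr0.
  by rewrite ler_norml h andbT lerNl -(lformN xilin) -(normrN v) h.
apply/(@cvgrPdist_lt _ _ _ (nbhs y)) => e e0.
apply/nbhs_ballP; exists (e / (L + 1)).
  by rewrite /= divr_gt0// ltr_wpDl.
move=> z; rewrite -ball_normE /= ltr_pdivlMr ?ltr_wpDl// -(lformB xilin).
apply: le_lt_trans; apply: le_trans (bnd _) _.
by rewrite mulrC ler_wpM2l// lerDl.
Qed.

End Clarke.

(** * Bounded operators and weak compactness *)

Section BoundedMaps.
Variables (R : realType) (X : normedModType R).

Lemma is_linear_bounded (Y : normedModType R) (g : X -> Y) :
  is_linear g -> continuous g -> exists2 C : R, 0 < C & forall x, `|g x| <= C * `|x|.
Proof.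
move=> glin gc.
pose gL : {linear X -> Y} := HB.pack g (GRing.isLinear.Build R X Y *:%R g glin).
have /linear_boundedP [y [yreal hy]] : bounded_near gL (nbhs 0).
  exact/linear_bounded_continuous.
exists (Num.max y 0 + 1); first by rewrite ltr_pwDr// le_max lexx orbT.
by apply: hy; rewrite (le_lt_trans (_ : y <= Num.max y 0)) ?ltrDl// le_max lexx.
Qed.

Lemma is_linear_lip (Y : normedModType R) (g : X -> Y) (C : R) :
  is_linear g -> (forall x, `|g x| <= C * `|x|) -> continuous g.
Proof.
move=> glin gC x; apply/(@cvgrPdist_lt _ _ _ (nbhs x)) => e e0.
have C0 : 0 < `|C| + 1 by rewrite ltr_wpDl.
apply/nbhs_ballP; exists (e / (`|C| + 1)); first by rewrite /= divr_gt0.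
move=> z; rewrite -ball_normE /= ltr_pdivlMr// -(lmapB glin).
apply: le_lt_trans; apply: le_trans (gC _) _.
rewrite mulrC ler_wpM2l// (le_trans (ler_norm C))// lerDl//.
Qed.

Lemma is_dual_bounded (g : X -> R) : is_dual g ->
  exists2 C : R, 0 < C & forall x, `|g x| <= C * `|x|.
Proof. by move=> [glin gc]; exact: (@is_linear_bounded R^o g glin gc). Qed.

Lemma is_dual_lip (g : X -> R) (C : R) :
  (forall a x y, g (a *: x + y) = a * g x + g y) ->
  (forall x, `|g x| <= C * `|x|) -> is_dual g.
Proof. by move=> glin gC; split=> //; exact: (@is_linear_lip R^o g C glin gC). Qed.

Lemma ler_dnorm (g : X -> R) x : is_dual g -> `|g x| <= dnorm g * `|x|.
Proof.
move=> gd; have [C C0 hC] := is_dual_bounded gd; have [glin _] := gd.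
have [->|x0] := eqVneq x 0; first by rewrite (lform0 glin) !normr0 mulr0.
rewrite -ler_pdivrMr ?normr_gt0//.
have -> : `|g x| / `|x| = `|g (`|x|^-1 *: x)|.
  by rewrite (lformZ glin) normrM normfV normr_id mulrC.
apply: ub_le_sup.
  exists C => _ [y /= y1 <-]; apply: le_trans (hC y) _.
  by rewrite ler_piMr// ltW.
by exists (`|x|^-1 *: x) => //=; rewrite normrZ normfV normr_id mulVf ?normr_eq0.
Qed.

Lemma dnorm_ge0 (g : X -> R) : is_dual g -> 0 <= dnorm g.
Proof.
move=> gd; have [C C0 hC] := is_dual_bounded gd.
apply: le_trans (normr_ge0 (g 0)) _; apply: ub_le_sup.
  exists C => _ [y /= y1 <-]; apply: le_trans (hC y) _.
  by rewrite ler_piMr// ltW.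
by exists 0 => //=; rewrite normr0.
Qed.

End BoundedMaps.

(** The growth hypothesis speaks of subgradients only. Hahn-Banach on the line through [v] produces
    a subgradient with value exactly [J0 (x; v)] at [v]. *)
Lemma clarke_growth (R : realType) (U : completeNormedModType R) (J : U -> R) d :
  loc_lipschitz J ->
  (forall u xi, clarke_subdiff J u xi -> dnorm xi <= d * (1 + `|u|)) ->
  forall x v, clarke J x v <= d * (1 + `|x|) * `|v|.
Proof.
move=> Jlip Jgr x v; have sc := clarke_sublinear Jlip x.
have [||t|xi [xilin xile xiE]] := @hahn_banach R U R^o _ (fun t => t *: v)
    (fun t => t * clarke J x v) sc.
- by move=> a s t; rewrite scalerDl scalerA.
- by move=> a s t; rewrite mulrDl mulrA.
- have [t0|t0|<-] := ltgtP 0 t.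
  + by rewrite sublinearZ.
  + have := @sublinearZ _ _ _ (- t) v sc; rewrite oppr_gt0 => /(_ t0).
    have := sublinearN (t *: v) sc; rewrite scaleNr => h hE.
    by move: h; rewrite hE mulNr opprK.
  + by rewrite scale0r mul0r sublinear0.
have xid := clarke_subdiff_of_le Jlip xilin xile.
have := xiE 1; rewrite scale1r mul1r => <-.
apply: le_trans (ler_norm _) _; apply: le_trans (ler_dnorm _ (proj1 xid)) _.
by rewrite ler_wpM2r// Jgr.
Qed.

Section WeakCompactness.
Variable R : realType.

Lemma ultra_bounded_cvg (T : Type) (F : set_system T) (u : T -> R) (M : R) :
  UltraFilter F -> (forall n, `|u n| <= M) -> exists l : R, u @ F --> l.
Proof.
move=> FU uM; have [|l [_ cl]] := @segment_compact R (- M) M (u @ F) _.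
  suff : F (fun n => u n \in `[- M, M]) by [].
  by apply: filterE => n; rewrite in_itv/= -ler_norml.
exists l => B lB; have [//|FnB] := in_ultra_setVsetC (u @^-1` B) FU.
have [|x [[y By <-] ]] := cl (u @` (~` (u @^-1` B))) B _ lB.
  suff : F (u @^-1` (u @` (~` (u @^-1` B)))) by [].
  by apply: filterS FnB => n; exists n.
by move=> /By.
Qed.

(** Along an ultrafilter every bounded scalar sequence [g (u n)] converges, and the limits define a
    bounded functional of [g]; reflexivity represents it by a point. *)
Lemma reflexive_ultra (V : normedModType R) (T : Type) (F : set_system T)
    (u : T -> V) (M : R) :
  reflexive_space V -> UltraFilter F -> (forall n, `|u n| <= M) ->
  exists x, forall g, is_dual g -> (g \o u) @ F --> g x.
Proof.
move=> Vrefl FU uM.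
have cvgl g : is_dual g -> exists l : R, (g \o u) @ F --> l.
  move=> gd; apply: (@ultra_bounded_cvg _ _ _ (dnorm g * M)) => // n /=.
  by rewrite (le_trans (ler_dnorm _ gd))// ler_wpM2l ?dnorm_ge0.
pose Phi (g : V -> R) : R := lim ((g \o u) @ F).
have PhiP g : is_dual g -> (g \o u) @ F --> Phi g.
  by move=> /cvgl[l gl]; apply/cvg_ex; exists l.
have [||x xP] := Vrefl Phi.
- move=> a g1 g2 gd1 gd2; apply: cvg_lim => //.
  apply: cvgD; last exact: PhiP.
  by apply: cvgM; [exact: cvg_cst|exact: PhiP].
- exists M => g gd; have h : (fun n => `|g (u n)|) @ F --> `|Phi g|.
    exact: cvg_norm (PhiP g gd).
  apply: (cvgr_to_le h); apply: (@filterE _ F) => n.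
  rewrite mulrC (le_trans (ler_dnorm _ gd))//.
  by rewrite ler_wpM2l ?dnorm_ge0.
by exists x => g gd; rewrite -xP//; exact: PhiP.
Qed.

(** Every ultrafilter finer than [\oo] has a weak limit sent by [i] to [h], hence the same one by
    injectivity. This gives weak convergence of the whole sequence: a failure for some [g] would
    live on an ultrafilter containing the bad indices. *)
Lemma weak_cvg_of_image (V H : normedModType R) (ip : H -> H -> R) (i : V -> H)
    (u : nat -> V) (M : R) (h : H) :
  reflexive_space V -> hilbert_ip ip -> (forall y, continuous (ip y)) ->
  is_linear i -> continuous i ->
  injective i -> (forall n, `|u n| <= M) -> (i \o u) @ \oo --> h ->
  exists2 x, i x = h & weak_cvg u x.
Proof.
move=> Vrefl [iplin [ipC ipn]] ipc ilin ic iinj uM uh.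
have ipr y a x z : ip y (a *: x + z) = a * ip y x + ip y z.
  by rewrite !(ipC y) iplin.
have key F : UltraFilter F -> \oo `<=` F ->
    exists2 x, i x = h & forall g, is_dual g -> (g \o u) @ F --> g x.
  move=> FU Foo; have [x xP] := reflexive_ultra Vrefl FU uM.
  exists x => //; apply/eqP; rewrite -subr_eq0 -normr_eq0 -sqrf_eq0 -ipn.
  set y := i x - h.
  have gd : is_dual (fun v => ip y (i v)).
    split=> [a v w|v]; first by rewrite ilin ipr.
    by apply: (@continuous_comp _ _ _ i (ip y)); [exact: ic|exact: ipc].
  have l1 : (fun n => ip y (i (u n))) @ F --> ip y (i x) := xP _ gd.
  have l2 : (fun n => ip y (i (u n))) @ F --> ip y h.
    apply: (@cvg_comp _ _ _ (i \o u) (ip y) F (nbhs h)); last exact: ipc.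
    by move=> B /uh /Foo.
  have E : ip y (i x) = ip y h by exact: (cvg_unique _ l1 l2).
  by rewrite {2}/y (lformB (ipr y)) E subrr.
have [F0 [FU0 F0oo]] := ultraFilterLemma (@eventually_filter).
have [x ixh _] := key F0 FU0 F0oo.
exists x => // g gd; apply/(@cvgrPdist_lt _ _ _ \oo) => e e0.
apply: contrapT => nev.
pose B := [set n | ~ (`|g x - g (u n)| < e)].
have PF : ProperFilter (within B \oo).
  apply: Build_ProperFilter_ex => D; rewrite /within /= => hD.
  apply: contrapT => nD; apply: nev; apply: filterS hD => n /= hn.
  by apply: contrapT => Bn; apply: nD; exists n; exact: hn.
have [F [FU FB]] := ultraFilterLemma PF.
have Foo : \oo `<=` F.
  by move=> D hD; apply: FB; apply: filterS hD => n Dn _.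
have [x' ix'h gx'] := key F FU Foo.
have xx' : x' = x by apply: iinj; rewrite ixh.
have := gx' g gd; rewrite xx' => /(@cvgrPdist_lt _ _ _ F)/(_ e e0) Fe.
have FBB : F B by apply: FB; rewrite /within /=; apply: (@filterE _ \oo).
by have [n [h1 h2]] := filter_ex (@filterI _ F _ _ _ Fe FBB).
Qed.

(** Instead of strict monotonicity only [n <= s n] is recorded; it suffices for transporting
    properties that hold from some index on. *)
Lemma compact_subseq (Y : normedModType R) (K : set Y) (y : nat -> Y) :
  compact K -> (forall n, K (y n)) ->
  exists (l : Y) (s : nat -> nat), (forall n, (n <= s n)%N) /\ (y \o s) @ \oo --> l.
Proof.
move=> cK yK; have [|l [_ cl]] := cK (y @ \oo) _; first by exists 0%N => // n _; exact: yK.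
exists l; have /choice[s sP] n : exists m, (n <= m)%N /\ `|l - y m| < n.+1%:R^-1.
  have [||_ [[m /= nm <-]]] := cl [set y k | k in [set k | (n <= k)%N]] (ball l n.+1%:R^-1).
  - by exists n => // k /= nk; exists k.
  - by apply: nbhsx_ballx; rewrite invr_gt0 ltr0Sn.
  by rewrite -ball_normE => h; exists m.
exists s; split=> [n|]; first by case: (sP n).
apply/cvgrPdist_lt => e e0; have [N hN] := harmonic_lt e0.
by exists N => // k /= Nk; apply: lt_trans (proj2 (sP k)) (hN _ Nk).
Qed.

Lemma compact_op_subseq (X Y : normedModType R) (g : X -> Y) (u : nat -> X) (M : R) :
  compact_op g -> (forall n, `|u n| <= M) ->
  exists (l : Y) (s : nat -> nat), (forall n, (n <= s n)%N) /\ (g \o u \o s) @ \oo --> l.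
Proof.
move=> gc uM; have gK : compact (closure (g @` range u)).
  by apply: gc; exists M => _ [n _ <-].
apply: (compact_subseq gK) => n; apply: subset_closure.
by exists (u n) => //; exists n.
Qed.

(** Normalised counterexamples with constants [n] have images converging in [Z] to some [z]. Their
    images in [H] tend to zero, so [z = 0] by injectivity of [j], against [e < |i (w n)|]. *)
Lemma ehrling (V Z H : normedModType R) (i : V -> Z) (j : Z -> H) e :
  is_linear i -> compact_op i -> is_linear j -> continuous j -> injective j ->
  0 < e -> exists2 C : R, 0 <= C & forall v, `|i v| <= e * `|v| + C * `|j (i v)|.
Proof.
move=> ilin ic jlin jc jinj e0; apply: contrapT => nC.
have /choice[w wP] n : exists v, `|v| = 1 /\ e + n%:R * `|j (i v)| < `|i v|.
  apply: contrapT => nv; apply: nC; exists n%:R => // v.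
  rewrite leNgt; apply/negP => h; apply: nv; exists (`|v|^-1 *: v).
  have v0 : 0 < `|v|.
    rewrite normr_gt0; apply/eqP => v0; move: h.
    by rewrite v0 (lmap0 ilin) (lmap0 jlin) !normr0 !mulr0 addr0 ltxx.
  rewrite (lmapZ ilin) (lmapZ jlin) !normrZ normfV normr_id mulVf ?gt_eqF//.
  split=> //; rewrite [X in _ < X]mulrC ltr_pdivlMr// mulrDl.
  rewrite (_ : n%:R * (_ * _) * _ = n%:R * `|j (i v)|)//.
  by field; rewrite gt_eqF.
have [|z [s [sn sz]]] := @compact_op_subseq _ _ i w 1 ic.
  by move=> n; rewrite (proj1 (wP n)).
have z0 : z = 0.
  apply: jinj; rewrite (lmap0 jlin).
  have jz : (fun n => j (i (w (s n)))) @ \oo --> j z.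
    by apply: (@cvg_comp _ _ _ _ j \oo (nbhs z)) => //; exact: jc.
  suff j0 : (fun n => j (i (w (s n)))) @ \oo --> (0 : H) by exact: (cvg_unique _ jz j0).
  have [C C0 hC] : exists2 C : R, 0 < C & forall n, `|i (w (s n))| <= C.
    have [C [_ hC]] := cvg_seq_bounded (cvgP _ sz).
    exists (`|C| + 1) => [|n]; first by rewrite ltr_wpDl.
    by apply: hC => //; rewrite ltr_pwDr// ler_norm.
  apply/(@cvgrPdist_lt _ _ _ \oo) => d d0.
  have [N hN] := @harmonic_lt R (d / C) ltac:(by rewrite divr_gt0).
  exists N.+1 => // -[//|n] /= Nn; rewrite sub0r normrN.
  have [_ h] := wP (s n.+1).
  have h1 : n.+1%:R * `|j (i (w (s n.+1)))| < C.
    apply: lt_le_trans (hC n.+1); apply: le_lt_trans h.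
    by apply: ler_wpDl; [exact: ltW|rewrite ler_wpM2r// ler_nat].
  have := hN n Nn; rewrite ltr_pdivlMr// mulrC => h2.
  by apply: le_lt_trans h2; rewrite ler_pdivlMr// mulrC ltW.
have /(@cvgrPdist_lt _ _ _ \oo)/(_ e e0)[N _ hN] := sz.
have := hN N (leqnn N); rewrite z0 sub0r normrN /= ltNge => /negP; apply.
rewrite ltW// (le_lt_trans _ (proj2 (wP _)))// lerDl.
by rewrite mulr_ge0.
Qed.

End WeakCompactness.

(** * Cauchy-Schwarz inequality and one-sided limits in epsilon form *)

Lemma cauchy_schwarz (R : realType) (H : normedModType R) (ip : H -> H -> R) x y :
  hilbert_ip ip -> `|ip x y| <= `|x| * `|y|.
Proof.
move=> [ipl [ipC ipn]].
have ipr z : forall a v w, ip z (a *: v + w) = a * ip z v + ip z w.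
  by move=> a v w; rewrite !(ipC z) ipl.
have [->|y0] := eqVneq y 0; first by rewrite (lform0 (ipr x)) !normr0 mulr0.
have ny : 0 < `|y| by rewrite normr_gt0.
set s := `|y| ^+ 2; have := sqr_ge0 `|s *: x + (- ip x y) *: y|.
rewrite -ipn ipl [ip (_ *: y) _]ipC (lformZ (ipr _)) [ip (_ + _) y]ipC !ipr.
rewrite !(lformZ (ipr _)) !ipn (ipC y x) => h.
have : (ip x y) ^+ 2 <= (`|x| * `|y|) ^+ 2.
  rewrite -(ler_pM2l (exprn_gt0 2 ny)) -subr_ge0; apply: le_trans h _.
  by rewrite le_eqVlt; apply/orP; left; apply/eqP; rewrite /s; ring.
by rewrite -real_normK ?num_real// ler_pXn2r// nnegrE mulr_ge0.
Qed.

Section Limits.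
Variable R : realType.

Lemma limn_esup_le0 (u : nat -> R) :
  (forall e, 0 < e -> \forall n \near \oo, u n <= e) ->
  (limn_esup (fun n => (u n)%:E) <= 0)%E.
Proof.
move=> h; apply/lee_addgt0Pr => e e0; rewrite add0e.
apply: ereal_inf_le.
exists (ereal_sup ((fun n => (u n)%:E) @` [set n | u n <= e])).
  by exists [set n | u n <= e] => //; exact: h.
by apply: ge_ereal_sup => _ [n /= un <-]; rewrite lee_fin.
Qed.

Lemma limn_einf_ge (u : nat -> R) c : (c%:E <= limn_einf (fun n => (u n)%:E))%E ->
  forall e, 0 < e -> \forall n \near \oo, c - e <= u n.
Proof.
rewrite /limn_einf leeNr -EFinN => h e e0.
have : (limn_esup (fun n => - (u n)%:E) < (- c + e)%:E)%E.
  by apply: le_lt_trans h _; rewrite lte_fin ltrDl.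
move=> /ereal_inf_lt[_ [B Boo <-] supB]; apply: filterS Boo => n Bn.
have := le_lt_trans (ereal_sup_ubound _) supB => /(_ (- (u n)%:E)%E).
rewrite -EFinN lte_fin => /(_ ltac:(by exists n)); lra.
Qed.

End Limits.

(** * Pseudomonotone operators and Ky Fan's principle *)

Lemma separable_seq (R : realType) (V : normedModType R) : separable_space V ->
  exists w : nat -> V, forall x e, 0 < e -> exists i, `|x - w i| < e.
Proof.
move=> [S [/countable_injP[f finj] clS]].
have /choice[w wP] n : exists x, forall y, S y -> f y = n -> x = y.
  have [[y [Sy fy]]|ny] := pselect (exists y, S y /\ f y = n).
    exists y => y' Sy' fy'; apply: finj; rewrite ?inE//.
    by rewrite fy fy'.
  by exists 0 => y Sy fy; case: ny; exists y.
exists w => x e e0; have clx : closure S x by rewrite clS.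
have [|y [Sy xy]] := clx (ball x e); first exact: nbhsx_ballx.
by exists (f y); rewrite (wP _ y)//; rewrite -ball_normE in xy.
Qed.

Lemma cvg_norm_bounded (R : realType) (V : normedModType R) (u : nat -> V) (x : V) :
  u @ \oo --> x -> exists2 M : R, 0 <= M & forall n, `|u n| <= M.
Proof.
move=> ux; have [C [_ hC]] := cvg_seq_bounded (cvgP _ ux).
exists (`|C| + 1) => [|n]; first by rewrite addr_ge0.
by apply: hC => //; rewrite ltr_pwDr// ler_norm.
Qed.

Lemma weak_cvg_of_cvg (R : realType) (V : normedModType R) (u : nat -> V) (x : V) :
  u @ \oo --> x -> weak_cvg u x.
Proof.
move=> ux g [_ gc].
by apply: (@cvg_comp _ _ _ u g \oo (nbhs x)) => //; exact: gc.
Qed.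

Section Pseudomonotone.
Variables (R : realType) (V : normedModType R) (A : V -> V -> R) (a b : R).
Hypothesis Adual : forall v, is_dual (A v).
Hypothesis Apm : pseudomonotone A.
Hypothesis b0 : 0 <= b.
Hypothesis Agr : forall v, dnorm (A v) <= a + b * `|v|.

Lemma ler_growth u v M : `|u| <= M -> `|A u v| <= (a + b * M) * `|v|.
Proof.
move=> uM; apply: le_trans (ler_dnorm _ (Adual u)) _; rewrite ler_wpM2r//.
by apply: le_trans (Agr u) _; rewrite lerD2l ler_wpM2l.
Qed.

Lemma pseudomonotone_near (u : nat -> V) x : weak_cvg u x ->
  (forall e, 0 < e -> \forall n \near \oo, A (u n) (u n - x) <= e) ->
  forall y e, 0 < e -> \forall n \near \oo, A x (x - y) - e <= A (u n) (u n - y).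
Proof.
move=> ux h y e e0.
exact: (limn_einf_ge (Apm ux (limn_esup_le0 h) y) e0).
Qed.

(** For strong convergence the growth bound sends [A (u n) (u n - x)] to zero, so pseudomonotonicity
    applies. This is the closedness that Ky Fan's principle requires. *)
Lemma pseudomonotone_demicontinuous (u : nat -> V) (x w : V) e : u @ \oo --> x -> 0 < e ->
  \forall n \near \oo, A (u n) (w - u n) <= A x (w - x) + e.
Proof.
move=> ux e0; have [M M0 uM] := cvg_norm_bounded ux.
pose K := `|a + b * M| + 1; have K0 : 0 < K by rewrite ltr_wpDl.
have small d : 0 < d -> \forall n \near \oo, A (u n) (u n - x) <= d.
  move=> d0; have dK : 0 < d / K by rewrite divr_gt0.
  have /(@cvgrPdist_lt _ _ _ \oo)/(_ _ dK) := ux.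
  apply: filterS => n; rewrite ltr_pdivlMr// distrC => un.
  apply: le_trans (ler_norm _) _; apply: le_trans (ler_growth _ (uM n)) _.
  apply: le_trans (ltW un); rewrite mulrC ler_wpM2l// (le_trans (ler_norm _))//.
  by rewrite lerDl.
have := pseudomonotone_near (weak_cvg_of_cvg ux) small w e0.
apply: filterS => n; rewrite -(opprB x w) -(opprB (u n) w) !(lformN (proj1 (Adual _))).
lra.
Qed.

End Pseudomonotone.

(** KKM on the barycentric coordinates of the points [w i]. The vectors [w i - pt p] have weighted
    sum zero, so by sublinearity [phi (pt p)] cannot be negative on all those of positive weight. *)
Lemma ky_fan (R : realType) (V : normedModType R) (phi : V -> V -> R) (n : nat)
    (w : 'I_n.+1 -> V) :
  (forall u, sublinear (phi u)) ->
  (forall (u : nat -> V) (x v : V), u @ \oo --> x -> (forall k, 0 <= phi (u k) (v - u k)) ->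
     0 <= phi x (v - x)) ->
  exists u, forall i, 0 <= phi u (w i - u).
Proof.
move=> phis phic; pose pt (p : 'rV[R]_n.+1) := \sum_i p ord0 i *: w i.
pose G i := simplex (R := R) (n := n) `&` [set p | 0 <= phi (pt p) (w i - pt p)].
have [||p _ pG] := @KKM R n G.
- move=> i p /closure_seq[y Gy yp]; split.
    apply: (@closed_cvg _ _ \oo _ y (@simplex R n) (@closed_simplex R n) _ p yp).
    by apply: (@filterE _ \oo) => k; case: (Gy k).
  apply: (phic (pt \o y)) => [|k]; last by case: (Gy k).
  apply: (@cvg_sumr _ _ \oo) => j; apply: cvgZr_tmp.
  apply: (@cvg_comp _ _ _ y (fun p : 'rV[R]_n.+1 => p ord0 j) \oo (nbhs p)) => //.
  exact: coord_continuous.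
- move=> p sp; have [p0 p1] := sp; apply: contrapT => nG.
  have neg i : 0 < p ord0 i -> phi (pt p) (w i - pt p) < 0.
    move=> pi; rewrite ltNge; apply/negP => h; apply: nG.
    by exists i.
  have E : \sum_i p ord0 i *: (w i - pt p) = 0.
    under eq_bigr do rewrite scalerBr.
    by rewrite sumrB -scaler_suml p1 scale1r subrr.
  have le (I : seq 'I_n.+1) : phi (pt p) (\sum_(i <- I) p ord0 i *: (w i - pt p)) <=
      \sum_(i <- I) p ord0 i * phi (pt p) (w i - pt p).
    elim: I => [|i I IH]; first by rewrite !big_nil sublinear0.
    rewrite !big_cons (le_trans (proj1 (phis _) _ _))// lerD//.
    have := p0 i; rewrite le_eqVlt => /orP[/eqP<-|pi].
      by rewrite scale0r mul0r sublinear0.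
    by rewrite sublinearZ.
  have := le (index_enum _); rewrite E sublinear0// leNgt => /negP; apply.
  have [i pi] : exists i, 0 < p ord0 i.
    apply: contrapT => /forallNP h.
    have : \sum_i p ord0 i = 0.
      apply: big1 => i _; apply/eqP; rewrite eq_le p0 andbT leNgt.
      by apply/negP/h.
    by rewrite p1 => /eqP; rewrite oner_eq0.
  rewrite (bigD1 i)//= -[ltRHS]addr0 ltr_leD//.
    by rewrite pmulr_rlt0// neg.
  apply: sumr_le0 => j _; have := p0 j; rewrite le_eqVlt => /orP[/eqP<-|pj].
    by rewrite mul0r.
  by rewrite pmulr_rle0// ltW// neg.
by exists (pt p) => i; case: (pG i).
Qed.

Lemma clarke_usc_cvg (R : realType) (U : completeNormedModType R) (J : U -> R)
    (y v : nat -> U) (y0 v0 : U) e : loc_lipschitz J ->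
  y @ \oo --> y0 -> v @ \oo --> v0 -> 0 < e ->
  \forall n \near \oo, clarke J (y n) (v n) <= clarke J y0 v0 + e.
Proof.
move=> Jlip yy vv e0; have [d d0 h] := clarke_usc Jlip y0 v0 e0.
have /(@cvgrPdist_lt _ _ _ \oo)/(_ _ d0) hy := yy.
have /(@cvgrPdist_lt _ _ _ \oo)/(_ _ d0) hv := vv.
apply: filterS2 hy hv => n yn vn.
by apply: h; rewrite distrC.
Qed.

Lemma ip_cvg (R : realType) (H : normedModType R) (ip : H -> H -> R)
    (x y : nat -> H) (x0 y0 : H) : hilbert_ip ip ->
  x @ \oo --> x0 -> y @ \oo --> y0 -> (fun n => ip (x n) (y n)) @ \oo --> ip x0 y0.
Proof.
move=> hip xx yy; have [ipl [ipC ipn]] := hip.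
have [M M0 yM] := cvg_norm_bounded yy.
pose K := M + `|x0| + 1; have K0 : 0 < K by rewrite ltr_wpDl// addr_ge0.
apply/(@cvgrPdist_lt _ _ _ \oo) => e e0.
have eK : 0 < e / 2 / K by rewrite !divr_gt0.
have /(@cvgrPdist_lt _ _ _ \oo)/(_ _ eK) hx := xx.
have /(@cvgrPdist_lt _ _ _ \oo)/(_ _ eK) hy := yy.
apply: filterS2 hx hy => n; rewrite !(ltr_pdivlMr _ _ K0) => xn yn.
have iplB u v z : ip (u - v) z = ip u z - ip v z by exact: (lformB (fun a s t => ipl a s t z)).
have -> : ip x0 y0 - ip (x n) (y n) = ip (y0 - y n) x0 + ip (x0 - x n) (y n).
  by rewrite !iplB (ipC (y n)) (ipC y0); ring.
apply: le_lt_trans (ler_normD _ _) _; rewrite (splitr e) ltrD//.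
  apply: le_lt_trans yn; apply: le_trans (cauchy_schwarz _ _ hip) _.
  by rewrite ler_wpM2l// /K; have := normr_ge0 x0; lra.
apply: le_lt_trans xn; apply: le_trans (cauchy_schwarz _ _ hip) _.
by rewrite ler_wpM2l// /K; have := yM n; have := normr_ge0 x0; lra.
Qed.

(** * The stationary inclusion *)

Section StationaryInclusion.
Variables (R : realType) (V H U Z : completeNormedModType R).
Variables (ip : H -> H -> R) (iV : V -> H) (iota : V -> U).
Variables (iVZ : V -> Z) (iZH : Z -> H) (iZU : Z -> U).
Variables (A : V -> V -> R) (a b alpha beta : R) (J : U -> R) (d : R).
Hypotheses (Vrefl : reflexive_space V) (Vsep : separable_space V).
Hypothesis hip : hilbert_ip ip.
Hypotheses (iVlin : is_linear iV) (iVcont : continuous iV) (iVinj : injective iV).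
Hypotheses (Adual : forall v, is_dual (A v)) (Apm : pseudomonotone A).
Hypotheses (b0 : 0 <= b) (Agr : forall v, dnorm (A v) <= a + b * `|v|).
Hypotheses (alpha0 : 0 < alpha) (beta0 : 0 <= beta).
Hypothesis Acoer : forall v, A v v >= alpha * `|v| ^+ 2 - beta * `|iV v| ^+ 2.
Hypotheses (Jlip : loc_lipschitz J) (d0 : 0 < d).
Hypothesis Jgr : forall u xi, clarke_subdiff J u xi -> dnorm xi <= d * (1 + `|u|).
Hypotheses (iotalin : is_linear iota) (iotacont : continuous iota).
Hypotheses (iVZlin : is_linear iVZ) (iVZcomp : compact_op iVZ).
Hypotheses (iZHlin : is_linear iZH) (iZHcont : continuous iZH) (iZHinj : injective iZH).
Hypotheses (iZUlin : is_linear iZU) (iZUcont : continuous iZU).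
Hypothesis iVfac : forall v, iV v = iZH (iVZ v).
Hypothesis iotafac : forall v, iota v = iZU (iVZ v).

Let ipr (z : H) (t : R) (x y : H) : ip z (t *: x + y) = t * ip z x + ip z y.
Proof. by have [l [c _]] := hip; rewrite !(c z) l. Qed.

(** Ehrling's inequality squared. The factor 2 in [q] comes from the square of a sum, and [e' <= 1]
    allows [e' ^+ 2 <= e']. *)
Lemma iota_interpolation e : 0 < e -> exists2 C : R, 0 <= C &
  forall v, `|iota v| ^+ 2 <= e * `|v| ^+ 2 + C * `|iV v| ^+ 2.
Proof.
move=> e0; have [k k0 hk] := is_linear_bounded iZUlin iZUcont.
pose q := 2 * k ^+ 2; have q0 : 0 < q by rewrite mulr_gt0// exprn_gt0.
pose e' := Num.min 1 (e / q).
have e'0 : 0 < e' by rewrite lt_min ltr01 divr_gt0.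
have [C C0 hC] := ehrling iVZlin iVZcomp iZHlin iZHcont iZHinj e'0.
exists (q * C ^+ 2) => [|v]; first by rewrite mulr_ge0 ?sqr_ge0// ltW.
have h1 : `|iota v| <= k * (e' * `|v| + C * `|iV v|).
  rewrite iotafac (le_trans (hk _))// ler_wpM2l ?(ltW k0)//.
  by rewrite iVfac hC.
have h2 : `|iota v| ^+ 2 <= (k * (e' * `|v| + C * `|iV v|)) ^+ 2.
  by rewrite ler_pXn2r// nnegrE// (le_trans _ h1).
apply: (le_trans h2).
have h3 : q * e' ^+ 2 <= e.
  have e'1 : e' <= 1 by rewrite ge_min lexx.
  have e'q : q * e' <= e by rewrite mulrC -ler_pdivlMr// ge_min lexx orbT.
  apply: le_trans e'q; rewrite ler_wpM2l ?(ltW q0)// expr2.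
  by rewrite ler_piMr// ltW.
have : q * e' ^+ 2 * `|v| ^+ 2 <= e * `|v| ^+ 2 by rewrite ler_wpM2r// sqr_ge0.
have := sqr_ge0 (k * (e' * `|v| - C * `|iV v|)); rewrite /q.
by nra.
Qed.

Section Fixed.
Variables (kappa : R) (F : V -> R).
Hypothesis kappa0 : 0 <= kappa.
Hypothesis Fdual : is_dual F.

Definition hvi_form (u v : V) : R :=
  kappa * ip (iV u) (iV v) + A u v - F v + clarke J (iota u) (iota v).

Definition hvi_lin (u v : V) : R := F v - kappa * ip (iV u) (iV v) - A u v.

Lemma hvi_lin_linear u s x y : hvi_lin u (s *: x + y) = s * hvi_lin u x + hvi_lin u y.
Proof.
rewrite /hvi_lin (proj1 Fdual) (proj1 (Adual u)) iVlin ipr; ring.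
Qed.

Lemma hvi_form_sublinear u : sublinear (hvi_form u).
Proof.
have [cD cZ] := clarke_sublinear Jlip (iota u).
have lin := hvi_lin_linear u.
have E v : hvi_form u v = clarke J (iota u) (iota v) - hvi_lin u v.
  by rewrite /hvi_form /hvi_lin; ring.
split=> [v w|t v t0]; rewrite !E.
  rewrite (lmapD iotalin) (lformD lin); have := cD (iota v) (iota w); lra.
rewrite (lmapZ iotalin) (lformZ lin); have := cZ t (iota v) t0; lra.
Qed.

(** The part of [hvi_form u (w - u)] without [A]: it is upper semicontinuous under strong
    convergence in [H] and [U] and convergence of [F], leaving [A] to pseudomonotonicity. *)
Definition hvi_rest (u w : V) : R :=
  kappa * ip (iV u) (iV w - iV u) - (F w - F u) + clarke J (iota u) (iota w - iota u).

Lemma hvi_formE u w : hvi_form u (w - u) = hvi_rest u w + A u (w - u).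
Proof.
rewrite /hvi_form /hvi_rest (lmapB iVlin) (lmapB iotalin) (lformB (proj1 Fdual)).
ring.
Qed.

Lemma hvi_rest_usc (u : nat -> V) (x w : V) e :
  (iV \o u) @ \oo --> iV x -> (iota \o u) @ \oo --> iota x ->
  (F \o u) @ \oo --> F x -> 0 < e ->
  \forall n \near \oo, hvi_rest (u n) w <= hvi_rest x w + e.
Proof.
move=> uH uU uF e0; have e20 : 0 < e / 2 by rewrite divr_gt0.
have hv : (fun n => iota w - iota (u n)) @ \oo --> iota w - iota x.
  by apply: cvgB => //; exact: cvg_cst.
have hc := clarke_usc_cvg Jlip uU hv e20.
have hs : (fun n => kappa * ip (iV (u n)) (iV w - iV (u n)) - (F w - F (u n))) @ \oo
    --> kappa * ip (iV x) (iV w - iV x) - (F w - F x).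
  apply: cvgB; last by apply: cvgB => //; exact: cvg_cst.
  apply: cvgM; first exact: cvg_cst.
  by apply: (ip_cvg hip uH); apply: cvgB => //; exact: cvg_cst.
have /(@cvgrPdist_lt _ _ _ \oo)/(_ _ e20) hs' := hs.
apply: filterS2 hc hs' => n hc; rewrite ltr_distl => /andP[hs'' _].
move: hc hs''; rewrite /hvi_rest /=; lra.
Qed.

Lemma hvi_form_bound u : exists2 C : R, 0 < C & forall v, hvi_form u v <= C * `|v|.
Proof.
have [CV CV0 hCV] := is_linear_bounded iVlin iVcont.
have [CU CU0 hCU] := is_linear_bounded iotalin iotacont.
have [CF CF0 hCF] := is_dual_bounded Fdual.
have [CA CA0 hCA] := is_dual_bounded (Adual u).
have [r [r0 [L [L0 hL]]]] := clarke_lip Jlip (iota u).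
exists (kappa * (`|iV u| * CV) + CA + CF + L * CU).
  have p1 : 0 <= kappa * (`|iV u| * CV).
    by rewrite mulr_ge0// mulr_ge0// ltW.
  have p2 : 0 <= L * CU by rewrite mulr_ge0// ltW.
  lra.
move=> v; rewrite /hvi_form.
have h1 : kappa * ip (iV u) (iV v) <= kappa * (`|iV u| * CV) * `|v|.
  rewrite -mulrA ler_wpM2l// (le_trans (ler_norm _))//.
  by rewrite (le_trans (cauchy_schwarz _ _ hip))// -mulrA ler_wpM2l.
have h2 : A u v <= CA * `|v| by exact: le_trans (ler_norm _) (hCA v).
have h3 : - F v <= CF * `|v|.
  by apply: le_trans (ler_norm _) _; rewrite normrN hCF.
have h4 : clarke J (iota u) (iota v) <= L * CU * `|v|.
  apply: le_trans (hL _ (iota v) _) _; first by rewrite subrr normr0.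
  by rewrite -mulrA ler_wpM2l.
by rewrite !mulrDl; lra.
Qed.

Lemma hvi_form_closed (u : nat -> V) (x v : V) : u @ \oo --> x ->
  (forall k, 0 <= hvi_form (u k) (v - u k)) -> 0 <= hvi_form x (v - x).
Proof.
move=> ux h; apply/ler_addgt0Pr => e e0; have e20 : 0 < e / 2 by rewrite divr_gt0.
have cont (W : normedModType R) (g : V -> W) : continuous g -> (g \o u) @ \oo --> g x.
  by move=> gc; apply: (@cvg_comp _ _ _ u g \oo (nbhs x)) => //; exact: gc.
have h1 := hvi_rest_usc v (cont _ _ iVcont) (cont _ _ iotacont)
  (weak_cvg_of_cvg ux Fdual) e20.
have h2 := pseudomonotone_demicontinuous Adual Apm b0 Agr v ux e20.
have [n [h1n h2n]] := filter_ex (@filterI _ \oo _ _ _ h1 h2).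
by have := h n; rewrite !hvi_formE; lra.
Qed.

(** Of the coercivity [alpha], one half absorbs the quadratic growth of [J0], while [kappa] absorbs
    all terms in [|iV u|^2]; the other half is left against terms linear in [|u|]. *)
Lemma hvi_bound C0 (hC0 : forall v, d * `|iota v| ^+ 2 <=
    alpha / 2 * `|v| ^+ 2 + C0 * `|iV v| ^+ 2) : beta + C0 <= kappa ->
  exists M : R, forall u, 0 <= hvi_form u (0 - u) -> `|u| <= M.
Proof.
move=> kC; have [CU CU0 hCU] := is_linear_bounded iotalin iotacont.
have [CF CF0 hCF] := is_dual_bounded Fdual.
exists ((CF + d * CU) / (alpha / 2)) => u; rewrite sub0r /hvi_form.
rewrite (lmapN iVlin) (lformN (ipr _)) (proj2 (proj2 hip)) (lformN (proj1 (Adual u))).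
rewrite (lformN (proj1 Fdual)) (lmapN iotalin) => h.
have := clarke_growth Jlip Jgr (iota u) (- iota u); rewrite normrN => hJ.
have hF : F u <= CF * `|u| by exact: le_trans (ler_norm _) (hCF u).
have hd : d * `|iota u| <= d * CU * `|u| by rewrite -mulrA ler_wpM2l// ltW.
have hk : (beta + C0) * `|iV u| ^+ 2 <= kappa * `|iV u| ^+ 2.
  by rewrite ler_wpM2r// sqr_ge0.
have hA := Acoer u; have hC := hC0 u.
have q : alpha / 2 * `|u| ^+ 2 <= (CF + d * CU) * `|u|.
  move: hJ; rewrite mulrDr mulr1 mulrDl -mulrA -expr2 => hJ.
  move: hk; rewrite mulrDl => hk; rewrite mulrDl; lra.
have [->|u0] := eqVneq u 0.
  rewrite normr0 !divr_ge0 ?addr_ge0 ?mulr_ge0 ?(ltW CF0) ?(ltW d0) ?(ltW CU0)//.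
  exact: ltW.
rewrite ler_pdivlMr ?divr_gt0// mulrC.
by rewrite -(ler_pM2r (_ : 0 < `|u|)) ?normr_gt0// -mulrA -expr2.
Qed.

Lemma hvi_limit (u : nat -> V) (w : nat -> V) (M : R) :
  (forall x e, 0 < e -> exists i, `|x - w i| < e) ->
  (forall n, `|u n| <= M) -> (forall n i, (i <= n)%N -> 0 <= hvi_form (u n) (w i - u n)) ->
  exists x, forall v, 0 <= hvi_form x v.
Proof.
move=> wdense uM uw.
have [z [s [sn sz]]] := compact_op_subseq iVZcomp uM.
have comp (W : normedModType R) (g : Z -> W) : continuous g ->
    (g \o (iVZ \o u \o s)) @ \oo --> g z.
  by move=> gc; apply: (@cvg_comp _ _ _ _ g \oo (nbhs z)) => //; exact: gc.
have sH : (iV \o (u \o s)) @ \oo --> iZH z.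
  rewrite (_ : iV \o _ = iZH \o (iVZ \o u \o s)); first exact: comp.
  by apply/funext => n /=; rewrite iVfac.
have sU : (iota \o (u \o s)) @ \oo --> iZU z.
  rewrite (_ : iota \o _ = iZU \o (iVZ \o u \o s)); first exact: comp.
  by apply/funext => n /=; rewrite iotafac.
have ipc y : continuous (ip y).
  apply: (@is_linear_lip R H R^o (ip y) `|y|) => [t v v'|v]; first exact: ipr.
  exact: cauchy_schwarz.
have usM n : `|(u \o s) n| <= M by exact: uM.
have [x xh ux] := weak_cvg_of_image Vrefl hip ipc iVlin iVcont iVinj usM sH.
have xz : iVZ x = z by apply: iZHinj; rewrite -iVfac.
rewrite -xz -iotafac in sU; rewrite -xh in sH.
have near_ge i : \forall n \near \oo, 0 <= hvi_form (u (s n)) (w i - u (s n)).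
  by exists i => // n /= i_n; apply: uw; exact: leq_trans i_n (sn n).
have [C C0 hC] := hvi_form_bound x.
have [CA CA0 hCA] := is_dual_bounded (Adual x).
pose K := C + CA + `|a + b * M| + 1.
have K0 : 0 < K by rewrite /K; have := normr_ge0 (a + b * M); lra.
(* As [x] is not a test point, a close [w i] replaces it. [K] collects the three prices: [C] for
   [hvi_form x], [CA] for [A x], and the growth bound for [A (u (s n))], all at [w i - x]. *)
have lim_le e : 0 < e -> \forall n \near \oo, A ((u \o s) n) ((u \o s) n - x) <= e.
  move=> e0; have [i] := wdense x (e / 2 / K) ltac:(by rewrite !divr_gt0).
  rewrite distrC (ltr_pdivlMr _ _ K0) => wi.
  have e20 : 0 < e / 2 by rewrite divr_gt0.
  have hr := hvi_rest_usc (w i) sH sU (ux F Fdual) e20.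
  apply: (@filterS2 _ \oo _ _ _ _ _ (near_ge i) hr) => n /=.
  rewrite hvi_formE => h1 h2; have := hC (w i - x); rewrite hvi_formE => h3.
  have := hCA (w i - x); have := ler_growth Adual b0 Agr (w i - x) (uM (s n)).
  move=> h4 h5.
  have h6 : (a + b * M) * `|w i - x| <= `|a + b * M| * `|w i - x|.
    by rewrite ler_wpM2r// ler_norm.
  have E : A (u (s n)) (u (s n) - x) =
      A (u (s n)) (w i - x) - A (u (s n)) (w i - u (s n)).
    rewrite -(lformB (proj1 (Adual _))); congr (A _ _).
    by rewrite opprB [RHS]addrC addrA subrK.
  have h7 := ler_norm (A (u (s n)) (w i - x)).
  have h8 := ler_norm (- A x (w i - x)); rewrite normrN in h8.
  rewrite E; move: wi; rewrite /K !mulrDr mulr1 ![`|w i - x| * _]mulrC => wi.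
  have := normr_ge0 (w i - x); lra.
have pm := pseudomonotone_near Apm ux lim_le.
have xw i : 0 <= hvi_form x (w i - x).
  apply/ler_addgt0Pr => e e0; have e20 : 0 < e / 2 by rewrite divr_gt0.
  have [n [h1 [h2 h3]]] := filter_ex (@filterI _ \oo _ _ _ (near_ge i) (@filterI _ \oo _ _ _
    (hvi_rest_usc (w i) sH sU (ux F Fdual) e20) (pm (w i) _ e20))).
  move: h1 h3; rewrite !hvi_formE -(opprB (w i)) -(opprB (w i) (u (s n))).
  rewrite !(lformN (proj1 (Adual _))) => h1 h3; lra.
exists x => v; apply/ler_addgt0Pr => e e0.
(* Density extends the inequality from the directions [w i - x] to an arbitrary [v], the error being
   controlled by subadditivity and [hC]. *)
have [i] := wdense (v + x) (e / C) ltac:(by rewrite divr_gt0).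
rewrite ltr_pdivlMr// => hi.
have := proj1 (hvi_form_sublinear x) v (w i - x - v).
have -> : v + (w i - x - v) = w i - x by rewrite addrC subrK.
have := hC (w i - x - v); rewrite -normrN opprB opprB addrA.
by have := xw i; lra.
Qed.

(* The test point [0] heading [w'] is what bounds the approximate solutions. *)
Lemma hvi_solvable C0 (hC0 : forall v, d * `|iota v| ^+ 2 <=
    alpha / 2 * `|v| ^+ 2 + C0 * `|iV v| ^+ 2) : beta + C0 <= kappa ->
  exists x, forall v, 0 <= hvi_form x v.
Proof.
move=> kC; have [w wd] := separable_seq Vsep.
pose w' n := if n is k.+1 then w k else 0.
have [M hM] := hvi_bound hC0 kC.
have /choice[u uP] n : exists u, forall i, (i <= n)%N -> 0 <= hvi_form u (w' i - u).
  have [u hu] := @ky_fan R V hvi_form n (fun i => w' i) hvi_form_sublinear hvi_form_closed.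
  by exists u => i i_n; exact: (hu (Ordinal (i_n : (i < n.+1)%N))).
apply: (@hvi_limit u w' M) => [x e e0|n|n i i_n].
- by have [i hi] := wd x e e0; exists i.+1.
- exact: hM (uP n 0%N isT).
- exact: uP.
Qed.

Lemma inclusion_of_hvi x : (forall v, 0 <= hvi_form x v) ->
  exists xi, clarke_subdiff J (iota x) xi /\
    forall v, kappa * ip (iV x) (iV v) + A x v + xi (iota v) = F v.
Proof.
move=> hx; have [|xi [xilin xile xiE]] := hahn_banach (clarke_sublinear Jlip (iota x))
    iotalin (hvi_lin_linear x).
  by move=> v; have := hx v; rewrite /hvi_form /hvi_lin; lra.
exists xi; split; first exact: clarke_subdiff_of_le.
by move=> v; rewrite xiE /hvi_lin; ring.
Qed.

End Fixed.

Lemma stationary_inclusion : exists2 k0 : R, 0 < k0 & forall kappa F,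
  k0 <= kappa -> is_dual F ->
  exists x xi, clarke_subdiff J (iota x) xi /\
    forall v, kappa * ip (iV x) (iV v) + A x v + xi (iota v) = F v.
Proof.
(* After multiplication by [d], exactly half of the coercivity constant is spent. *)
have [C C0 hC] := @iota_interpolation (alpha / 2 / d) ltac:(by rewrite !divr_gt0).
have dC : 0 <= d * C by rewrite mulr_ge0// ltW.
(* The summand 1 makes the threshold positive, so that its inverse can bound the time step. *)
exists (beta + d * C + 1) => [|kappa F hk Fd]; first by rewrite ltr_wpDl// addr_ge0.
have [|||x hx] := @hvi_solvable kappa F _ Fd (d * C).
- by apply: le_trans hk; rewrite !addr_ge0.
- move=> v; have := hC v; rewrite -(ler_pM2l d0) mulrDr !mulrA.
  by rewrite (_ : d * alpha / 2 / d = alpha / 2)//; field; rewrite gt_eqF.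
- by apply: le_trans hk; rewrite lerDl.
have [xi h] := inclusion_of_hvi Fd hx.
by exists x, xi.
Qed.
End StationaryInclusion.

(** * The right-hand side *)

Section DualIntegral.
Variables (R : realType) (V : normedModType R) (T : R) (f : R -> V -> R).
Hypothesis fL2 : L2_dual T f.
Variables a b : R.
Hypotheses (a0 : 0 <= a) (bT : b <= T).

Local Notation mu := (@lebesgue_measure R).

Let sub : Icc a b `<=` Icc 0 T.
Proof.
move=> t; rewrite /Icc /= !in_itv/= => /andP[ta tb].
by rewrite (le_trans a0 ta) (le_trans tb bT).
Qed.

Let mI c e : measurable (Icc c e : set R).
Proof. exact: measurable_itv. Qed.

Let ft_dual t : Icc a b t -> is_dual (f t).
Proof. by move=> /sub; rewrite /Icc /= in_itv/=; case: fL2 => h _; exact: h. Qed.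

Let mf v : measurable_fun (Icc a b) (fun t => f t v).
Proof. by case: fL2 => _ [h _]; apply: measurable_funS (h v) => //; exact: mI. Qed.

Let integrable_bound :
  mu.-integrable (Icc a b) (fun t => (1 + dnorm (f t) ^+ 2)%:E).
Proof.
have [_ [_ [mn nfin]]] := fL2.
have fin : (mu (Icc a b) < +oo)%E.
  by rewrite /Icc lebesgue_measure_itv; case: ifP => _; rewrite /= -?EFinB ltry.
have i1 : mu.-integrable (Icc a b) (fun=> 1%:E).
  apply/integrableP; split; first exact: measurable_cst.
  rewrite (eq_integral (cst 1%E)); last by move=> t _; rewrite gee0_abs ?lee_fin.
  rewrite integral_cst; last exact: mI.
  by rewrite mul1e; exact: fin.
have i2 : mu.-integrable (Icc a b) (fun t => (dnorm (f t) ^+ 2)%:E).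
  apply: (@integrableS _ _ _ mu (Icc 0 T)); [exact: mI|exact: mI|exact: sub|].
  apply/integrableP; split.
    by apply/measurable_EFinP; exact: measurable_funX.
  rewrite (_ : integral _ _ _ = \int[mu]_(t in Icc 0 T) (dnorm (f t) ^+ 2)%:E)%E//.
  by apply: eq_integral => t _; rewrite gee0_abs ?lee_fin ?sqr_ge0.
exact: (@integrableD _ _ _ mu _ (mI a b) _ _ i1 i2).
Qed.

(** Bounding the dual norm by one plus its square yields an integrable majorant directly from the L2
    hypothesis. *)
Let f_le v t : Icc a b t -> `|f t v| <= `|v| * (1 + dnorm (f t) ^+ 2).
Proof.
move=> /ft_dual ftd; rewrite mulrC; apply: le_trans (ler_dnorm v ftd) _.
rewrite ler_wpM2r//; have := dnorm_ge0 ftd.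
have := sqr_ge0 (dnorm (f t) - 1); nra.
Qed.

Let integrable_f v : mu.-integrable (Icc a b) (fun t => (f t v)%:E).
Proof.
have X := @integrableZl _ _ _ mu _ (mI a b) `|v| _ integrable_bound.
apply: (@le_integrable _ _ _ mu _ (mI a b) _ _ _ _ X).
  by apply/measurable_EFinP; exact: mf.
move=> t It /=; rewrite lee_fin (le_trans (f_le _ It))//.
exact: ler_norm.
Qed.

Lemma dint_dual : is_dual (dint f a b).
Proof.
have E v : dint f a b v = (\int[mu]_(t in Icc a b) f t v)%R by [].
have iZ c v : mu.-integrable (Icc a b) (EFin \o (fun t => c * f t v)).
  exact: (@integrableZl _ _ _ mu _ (mI a b) c _ (integrable_f v)).
have ib c : mu.-integrable (Icc a b) (EFin \o (fun t => c * (1 + dnorm (f t) ^+ 2))).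
  exact: (@integrableZl _ _ _ mu _ (mI a b) c _ integrable_bound).
apply: (@is_dual_lip _ _ _ (\int[mu]_(t in Icc a b) (1 + dnorm (f t) ^+ 2))%R).
  move=> s x y; rewrite !E -(@RintegralZl _ _ _ mu _ _ s (mI a b) (integrable_f x)).
  rewrite -(@RintegralD _ _ _ mu _ _ _ (mI a b) (iZ s x) (integrable_f y)).
  apply: eq_Rintegral => t; rewrite inE => /ft_dual[ftl _].
  exact: ftl.
move=> v; rewrite E.
apply: le_trans (@le_normr_Rintegral _ _ _ mu _ _ (mI a b) (integrable_f v)) _.
rewrite mulrC -(@RintegralZl _ _ _ mu _ _ `|v| (mI a b) integrable_bound).
apply: (@le_Rintegral _ _ _ mu _ _ _ (mI a b) _ (ib `|v|)); last exact: f_le.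
exact: (@integrable_abse _ _ _ mu _ _ (integrable_f v)).
Qed.

End DualIntegral.

(** * Assembly of the two-step time scheme *)

Lemma is_dual_lin (R : realType) (V : normedModType R) (c : R) (g h : V -> R) :
  is_dual g -> is_dual h -> is_dual (fun v => c * g v + h v).
Proof.
move=> gd hd; have [C C0 hC] := is_dual_bounded gd; have [D D0 hD] := is_dual_bounded hd.
apply: (@is_dual_lip _ _ _ (`|c| * C + D)) => [s x y|v].
  by rewrite (proj1 gd) (proj1 hd); ring.
rewrite (le_trans (ler_normD _ _))// mulrDl lerD// normrM -mulrA.
by rewrite ler_wpM2l.
Qed.

Theorem theorem4p1
  (R : realType) (V H U Z : completeNormedModType R)
  (ipH : H -> H -> R) (iV : V -> H)
  (iota : V -> U) (iVZ : V -> Z) (iZH : Z -> H) (iZU : Z -> U)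
  (A : V -> V -> R) (a b alpha beta : R)
  (J : U -> R) (d : R) (T : R) (f : R -> V -> R) (u0 : H)
  (* V reflexive separable Banach, H separable Hilbert *)
  (hVrefl : reflexive_space V) (hVsep : separable_space V)
  (hH : hilbert_ip ipH) (hHsep : separable_space H)
  (* V subset H: dense, continuous, compact embedding; H = H^* subset V^*
     via h |-> (v |-> ipH h (iV v)) *)
  (hiVlin : is_linear iV) (hiVcont : continuous iV) (hiVinj : injective iV)
  (hiVdense : closure (range iV) = setT) (hiVcomp : compact_op iV)
  (* U reflexive Banach *)
  (hUrefl : reflexive_space U)
  (hT : 0 < T)
  (* H(A) *)
  (hAdual : forall v : V, is_dual (A v)) (hApm : pseudomonotone A)
  (ha : 0 <= a) (hb : 0 < b)
  (hAgrowth : forall v : V, dnorm (A v) <= a + b * `|v|)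
  (halpha : 0 < alpha) (hbeta : 0 <= beta)
  (hAcoer : forall v : V, A v v >= alpha * `|v| ^+ 2 - beta * `|iV v| ^+ 2)
  (* H(J) *)
  (hJlip : loc_lipschitz J) (hd : 0 < d)
  (hJgrowth : forall (u : U) (xi : U -> R), clarke_subdiff J u xi ->
                dnorm xi <= d * (1 + `|u|))
  (* H(iota) *)
  (hiotalin : is_linear iota) (hiotacont : continuous iota)
  (hiotacomp : compact_op iota)
  (hiVZlin : is_linear iVZ) (hiVZcont : continuous iVZ)
  (hiVZinj : injective iVZ) (hiVZcomp : compact_op iVZ)
  (hiZHlin : is_linear iZH) (hiZHcont : continuous iZH) (hiZHinj : injective iZH)
  (hiZUlin : is_linear iZU) (hiZUcont : continuous iZU)
  (hiVfac : forall v : V, iV v = iZH (iVZ v))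
  (hiotafac : forall v : V, iota v = iZU (iVZ v))
  (* H(f) *)
  (hf : L2_dual T f) :
  forall u0t : nat -> V,
  exists tau0 : R, 0 < tau0 /\
  forall N : nat, (0 < N)%N -> T / N%:R < tau0 ->
  let tau := T / N%:R in
  exists (u : nat -> V) (xi : nat -> U -> R),
    u 0%N = u0t N /\
    (forall n : nat, (1 <= n <= N)%N -> clarke_subdiff J (iota (u n)) (xi n)) /\
    (forall v : V,
       tau^-1 * ipH (iV (u 1%N - u 0%N)) (iV v) + A (u 1%N) v + xi 1%N (iota v)
       = tau^-1 * dint f 0 tau v) /\
    (forall n : nat, (2 <= n <= N)%N -> forall v : V,
       tau^-1 * ipH (iV ((3 / 2) *: u n - 2 *: u (n - 1)%N + (1 / 2) *: u (n - 2)%N))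
                    (iV v)
       + A (u n) v + xi n (iota v)
       = 3 / (2 * tau) * dint f ((n - 1)%N%:R * tau) (n%:R * tau) v
         - 1 / (2 * tau) * dint f ((n - 2)%N%:R * tau) ((n - 1)%N%:R * tau) v).
Proof.
move=> u0t.
have ipl := proj1 hH.
have [k0 k00 step] := stationary_inclusion hVrefl hVsep hH hiVlin hiVcont hiVinj
  hAdual hApm (ltW hb) hAgrowth halpha hbeta hAcoer hJlip hd hJgrowth hiotalin hiotacont
  hiVZlin hiVZcomp hiZHlin hiZHcont hiZHinj hiZUlin hiZUcont hiVfac hiotafac.
exists k0^-1; split; first by rewrite invr_gt0.
move=> N N0 tauk tau.
have Npos : 0 < N%:R :> R by rewrite ltr0n.
have tau0 : 0 < tau by rewrite divr_gt0.
have ktau : k0 <= tau^-1.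
  by rewrite -[k0]invrK ltW// ltf_pV2 ?posrE ?invr_gt0.
have ktau2 : k0 <= 3 / (2 * tau).
  apply: le_trans ktau _; rewrite (_ : 3 / (2 * tau) = 3 / 2 * tau^-1).
    have : 0 < tau^-1 by rewrite invr_gt0.
    lra.
  by field; rewrite gt_eqF.
(* A total solution operator for pairs [(kappa, F)], with a dummy value outside the solvable range,
   so that the iterates can be defined by plain recursion. *)
have /choice[S SP] (q : R * (V -> R)) : exists p : V * (U -> R),
    k0 <= q.1 -> is_dual q.2 -> clarke_subdiff J (iota p.1) p.2 /\
    forall v, q.1 * ipH (iV p.1) (iV v) + A p.1 v + p.2 (iota v) = q.2 v.
  have [[h1 h2]|h] := pselect (k0 <= q.1 /\ is_dual q.2).
    by have [x [xi h]] := step _ _ h1 h2; exists (x, xi).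
  by exists (0, fun=> 0) => h1 h2; case: h.
(* Known iterates go to the right-hand side, leaving the unknown with factor [1/tau] in the first
   step and [3/(2 tau)] later. In [F2], [p] is the previous iterate and [q] the one before it. *)
pose F1 (p : V) v := tau^-1 * dint f 0 tau v + tau^-1 * ipH (iV p) (iV v).
pose F2 n (p q : V) v := 3 / (2 * tau) * dint f ((n - 1)%N%:R * tau) (n%:R * tau) v
  - 1 / (2 * tau) * dint f ((n - 2)%N%:R * tau) ((n - 1)%N%:R * tau) v
  - tau^-1 * ipH (iV ((1 / 2) *: q - 2 *: p)) (iV v).
(* The state at [n] holds the [n]-th iterate, its predecessor and its multiplier; [next n] computes
   index [n.+1], by the one-step formula when [n] is 0. The predecessor stored at index 0 is a
   placeholder. *)
pose next n (st : V * V * (U -> R)) : V * V * (U -> R) :=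
  let r := if n == 0%N then S (tau^-1, F1 st.1.1)
           else S (3 / (2 * tau), F2 n.+1 st.1.1 st.1.2) in
  (r.1, st.1.1, r.2).
pose fix st n := if n is m.+1 then next m (st m) else (u0t N, u0t N, fun=> 0).
have ipdual (h : H) (c : R) : is_dual (fun v => c * ipH h (iV v)).
  have [C C0 hC] := is_linear_bounded hiVlin hiVcont.
  apply: (@is_dual_lip _ _ _ (`|c| * (`|h| * C))) => [s x y|v].
    by rewrite hiVlin; have [_ [ipC _]] := hH; rewrite !(ipC h) ipl; ring.
  rewrite normrM -mulrA ler_wpM2l// (le_trans (cauchy_schwarz _ _ hH))//.
  by rewrite -mulrA ler_wpM2l.
have NT : N%:R * tau = T by rewrite /tau mulrC divfK ?gt_eqF.
(* The bound [n <= N] keeps the interval of integration within [[0, T]], where [f] is controlled. *)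
have dd m n : (n <= N)%N -> is_dual (dint f (m%:R * tau) (n%:R * tau)).
  move=> nN; apply: (dint_dual hf); first by rewrite mulr_ge0// ltW.
  by rewrite -NT ler_wpM2r ?(ltW tau0)// ler_nat.
have F1d p : (1 <= N)%N -> is_dual (F1 p).
  move=> N1; apply: is_dual_lin (ipdual _ _).
  by have := dd 0%N 1%N N1; rewrite mul0r mul1r.
have F2d n p q : (n <= N)%N -> is_dual (F2 n p q).
  move=> nN; have nN1 : (n - 1 <= N)%N by exact: leq_trans (leq_subr _ _) nN.
  rewrite (_ : F2 n p q = fun v => 3 / (2 * tau) * dint f ((n - 1)%N%:R * tau) (n%:R * tau) v +
     (- (1 / (2 * tau)) * dint f ((n - 2)%N%:R * tau) ((n - 1)%N%:R * tau) v +
      (- tau^-1) * ipH (iV ((1 / 2) *: q - 2 *: p)) (iV v))); last first.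
    by apply/funext => v; rewrite /F2 !mulNr addrA.
  apply: is_dual_lin; first exact: dd.
  by apply: is_dual_lin; [exact: dd|exact: ipdual].
have P1 p := SP (tau^-1, F1 p) ktau (F1d p N0).
have P2 n p q (nN : (n <= N)%N) := SP (3 / (2 * tau), F2 n p q) ktau2 (F2d n p q nN).
exists (fun n => (st n).1.1), (fun n => (st n).2); split => //; split; last split.
- case=> [//|[|n]] /= nN; first by case: (P1 (u0t N)).
  by case: (P2 n.+2 (st n.+1).1.1 (st n.+1).1.2 nN).
- move=> v; have [_ /(_ v)] := P1 (u0t N); rewrite /= (lmapB hiVlin).
  rewrite (lformB (fun s x y => ipl s x y (iV v))) /F1 => h.
  by rewrite mulrBr; lra.
- case=> [//|[//|n]] nN v.
  have -> : st (n.+2 - 1)%N = st n.+1 by rewrite subn1.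
  have -> : st (n.+2 - 2)%N = st n by rewrite subn2.
  pose p := (st n.+1).1.1; pose q := (st n).1.1.
  have [_ /(_ v)] := P2 n.+2 p q nN.
  pose x := (S (3 / (2 * tau), F2 n.+2 p q)).1.
  pose xi := (S (3 / (2 * tau), F2 n.+2 p q)).2.
  change (3 / (2 * tau) * ipH (iV x) (iV v) + A x v + xi (iota v) = F2 n.+2 p q v ->
    tau^-1 * ipH (iV ((3 / 2) *: x - 2 *: p + (1 / 2) *: q)) (iV v) + A x v +
      xi (iota v) =
    3 / (2 * tau) * dint f ((n.+2 - 1)%N%:R * tau) (n.+2%:R * tau) v
    - 1 / (2 * tau) * dint f ((n.+2 - 2)%N%:R * tau) ((n.+2 - 1)%N%:R * tau) v).
  rewrite /F2 (_ : _ - _ + _ = (3 / 2) *: x + ((1 / 2) *: q - 2 *: p)); last first.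
    by rewrite -addrA [- _ + _]addrC.
  move=> h; rewrite hiVlin ipl.
  have -> : tau^-1 * (3 / 2 * ipH (iV x) (iV v) + ipH (iV ((1 / 2) *: q - 2 *: p)) (iV v))
     = 3 / (2 * tau) * ipH (iV x) (iV v) +
       tau^-1 * ipH (iV ((1 / 2) *: q - 2 *: p)) (iV v).
    by field; rewrite gt_eqF.
  lra.
Qed.
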